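(* Consider the step system. For every $h>h^{step}$, the foliation of the iso-energy surface $\{H=h\}$ into level sets $(e_1,h-e_1)$ with increasing $e_1$ value has two singularities at which the topology of the level sets changes: at $e_1=h_1^{step}$ the topology changes from a genus one surface to a genus two surface, whereas at $e_1=h-h_2^{step}$ the topology changes back to a genus one surface.
   Context: Smooth system. $H=H_1(q_1,p_1)+H_2(q_2,p_2)$, $H_i=\frac{p_i^2}{2}+V_i(q_i)$, where each $V_i:\mathbb{R}\to\mathbb{R}$ is $C^\infty$, has a single simple minimum at $0$, $V_i(0)=0$, $qV_i'(q)>0$ for all $q\ne0$, and $V_i(q)\to\infty$ as $|q|\to\infty$. Step and step flow. $S=\{(q_1,q_2): q_1<q_1^{wall}\text{ and }q_2<q_2^{wall}\}$ with $q_1^{wall}q_2^{wall}\neq0$. The step system is the Hamiltonian flow of $H$ on $(q_1,q_2)\in\mathbb{R}^2\setminus S$ with elastic reflections: on the 1-boundary ($q_1=q_1^{wall}$, $q_2<q_2^{wall}$) $p_1\to-p_1$, and on the 2-boundary ($q_1<q_1^{wall}$, $q_2=q_2^{wall}$) $p_2\to-p_2$. The energies $e_i=H_i$ are conserved. The level set $(e_1,e_2)$, $e_1,e_2>0$, is the set of points with $q\in\mathbb{R}^2\setminus S$ and $H_i(q_i,p_i)=e_i$, $i=1,2$, with boundary points identified according to the impact rule ($p_1\sim-p_1$ on the 1-boundary, $p_2\sim-p_2$ on the 2-boundary). Here $e_1$ ranges over $(0,h)$ and $e_2=h-e_1$. $h_i^{step}=V_i(q_i^{wall})$ and $h^{s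tep}=h_1^{step}+h_2^{step}$.
   Formalization: The impact rule is also applied at the step corner (q1wall, q2wall), which belongs to both boundaries; with the open boundary segments of the context the level sets in the genus two range would be non-Hausdorff and not surfaces. *)

(* Defs.v *)
From HB Require Import structures.
From Stdlib Require Import Relation_Operators.
From mathcomp Require Import all_boot all_order all_algebra generic_quotient.
From mathcomp Require Import all_classical all_reals all_analysis.
Import Order.TTheory GRing.Theory Num.Theory.
Import numFieldNormedType.Exports.

Set Implicit Arguments.
Unset Strict Implicit.
Unset Printing Implicit Defensive.

Local Open Scope classical_set_scope.
Local Open Scope ring_scope.

Definition homeomorphic (X Y : topologicalType) : Prop :=
  exists f : X -> Y, exists g : Y -> X,
    [/\ continuous f, continuous g, cancel f g & cancel g f].

Section IdentificationSpace.
Variables (X : topologicalType) (r : X -> X -> Prop).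

Definition glued : rel X := fun x y => `[< clos_refl_sym_trans X r x y >].

Lemma glued_refl : reflexive glued.
Proof. by move=> x; apply/asboolP; exact: rst_refl. Qed.

Lemma glued_sym : symmetric glued.
Proof. by move=> x y; apply: asbool_equiv_eq; split=> xy; apply: rst_sym. Qed.

Lemma glued_trans : transitive glued.
Proof.
by move=> y x z /asboolP xy /asboolP yz; apply/asboolP; exact: rst_trans xy yz.
Qed.

Definition glued_equiv : equiv_rel X :=
  EquivRel glued glued_refl glued_sym glued_trans.

(* X with x and y identified whenever r x y; r need not be an equivalence. *)
Definition identification_space : topologicalType :=
  quotient_topology {eq_quot glued_equiv}%qT.

End IdentificationSpace.

Section StandardSurface.
Variable R : realType.

(* The standard handlebody of genus g: a slab pierced by g holes in a row. *)
Definition pierced_slab (g : nat) : set (R * R * R) :=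
  [set u | [/\ 0 <= u.1.1 <= (2 * g + 1)%:R, 0 <= u.1.2 <= 3, 0 <= u.2 <= 1 &
    forall k : nat, (k < g)%N ->
      ~ ((2 * k + 1)%:R < u.1.1 < (2 * k + 2)%:R /\ 1 < u.1.2 < 2)]].

(* The closed orientable surface of genus g, as the boundary surface of the
   (closed) handlebody. *)
Definition standard_surface (g : nat) : set (R * R * R) :=
  pierced_slab g `\` interior (pierced_slab g).

Definition genus_surface (g : nat) (X : topologicalType) : Prop :=
  homeomorphic X (standard_surface g).

End StandardSurface.

Section StepSystem.
Variable R : realType.

(* The simple minimum is read as a nondegenerate one. *)
Record confining_potential (V : R -> R) : Prop := ConfiningPotential {
  potential_smooth : forall (n : nat) (q : R), derivable (V^`(n))%classic q 1;
  potential_at0 : V 0 = 0;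
  potential_unique_min : forall q : R, q != 0 -> V 0 < V q;
  potential_simple_min : 0 < (V^`(2))%classic 0;
  potential_single_well : forall q : R, q != 0 -> 0 < q * (V^`())%classic q;
  potential_cvg_pinfty : V q @[q --> +oo] --> +oo;
  potential_cvg_ninfty : V q @[q --> -oo] --> +oo }.

(* Points are ((q1, p1), (q2, p2)). *)
Definition phase_space : topologicalType := ((R * R) * (R * R))%type.

Definition energy (V : R -> R) (u : R * R) : R := u.2 ^+ 2 / 2 + V u.1.

Definition reflect_p (u : R * R) : R * R := (u.1, - u.2).

Variables (V1 V2 : R -> R) (q1wall q2wall : R).

Definition step_region : set (R * R) :=
  [set q | q.1 < q1wall /\ q.2 < q2wall].

Definition level_points (e1 e2 : R) : set phase_space :=
  [set x | [/\ ~ step_region (x.1.1, x.2.1),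
               energy V1 x.1 = e1 & energy V2 x.2 = e2]].

(* The step corner (q1wall, q2wall) belongs to both boundaries: with open
   boundary segments the four momenta (+-p1, +-p2) over the corner would be
   non-separated points of the level set. *)
Definition boundary1 : set phase_space :=
  [set x | x.1.1 = q1wall /\ x.2.1 <= q2wall].

Definition boundary2 : set phase_space :=
  [set x | x.1.1 <= q1wall /\ x.2.1 = q2wall].

Definition impact (x y : phase_space) : Prop :=
  (boundary1 x /\ y = (reflect_p x.1, x.2)) \/
  (boundary2 x /\ y = (x.1, reflect_p x.2)).

Definition level_set (e1 e2 : R) : topologicalType :=
  identification_space
    (fun x y : level_points e1 e2 => impact (set_val x) (set_val y)).

(* The leaves of the iso-energy surface H = h, indexed by e1. *)
Definition leaf (h e1 : R) : topologicalType := level_set e1 (h - e1).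

End StepSystem.

(* The homeomorphism type of F is not locally constant at e. *)
Definition topology_changes_at (R : realType) (F : R -> topologicalType)
    (e : R) : Prop :=
  ~ \forall e' \near e, homeomorphic (F e') (F e).

(* Main.v *)
Require Import Defs.
From Stdlib Require Import Relation_Operators.
From mathcomp Require Import all_boot all_order all_algebra ring lra generic_quotient.
From mathcomp Require Import all_classical all_reals all_analysis.
Import Order.TTheory GRing.Theory Num.Theory.
Import numFieldNormedType.Exports.

(** Over a configuration (q1, q2) a level set has four points, given by the
signs of the two momenta, and they merge where a momentum vanishes or a wall
is hit.  A level set is therefore its configuration polygon doubled twice: the
copies p1 > 0 and p1 < 0 meet along the vertical edges, the copies p2 > 0 and
p2 < 0 along the horizontal ones.  The standard surface of genus g is doubled
in the same way by the reflections z -> 1 - z and y -> 3 - y: they cut it into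
four copies of a disc whose boundary consists of g + 1 arcs in the plane
z = 1/2 alternating with g + 1 arcs in the plane y = 3/2.  So it is enough to
map the configuration polygon bijectively and continuously onto this quarter
of the surface, vertical edges going to arcs of the first kind and horizontal
edges to arcs of the second kind (doubled_surface, level_genus); compactness
takes care of the inverse (compact_identification).

If e1 < h1step the motion in q1 does not reach the wall and the polygon is a
rectangle, with four edges: genus one.  If h1step < e1 < h - h2step both walls
are inside the ranges of motion and the polygon is an L-shaped hexagon: genus
two.  The case e1 > h - h2step is the first one with the coordinates swapped
(level_set_swap), which also exchanges the two singular values.

At e1 = h1step the wall q1 = q1wall is a turning point.  If it is the left
one, the level set is a torus on which two points are identified, and if it is
the right one, a torus with a circle attached at a point.  Either way one
point has a neighbourhood that it separates (local_cut_point_left,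
local_cut_point_right).  A torus has no such point: it is a product of two
circles, and removing a point from a product of two nontrivial connected sets
leaves a connected set (prod_no_local_cut_point).  Hence the singular leaf is
not homeomorphic to the nearby tori, while around any other value of e1 the
homeomorphism type is constant. *)

Set Implicit Arguments.
Unset Strict Implicit.
Unset Printing Implicit Defensive.

Local Open Scope classical_set_scope.
Local Open Scope ring_scope.

(** * Continuity and identification spaces *)

Lemma homeomorphic_sym (X Y : topologicalType) : homeomorphic X Y -> homeomorphic Y X.
Proof. by move=> [f [g [? ? ? ?]]]; exists g, f. Qed.

Lemma homeomorphic_trans (X Y Z : topologicalType) :
  homeomorphic X Y -> homeomorphic Y Z -> homeomorphic X Z.
Proof.
move=> [f [g [cf cg fK gK]]] [f' [g' [cf' cg' fK' gK']]].
exists (f' \o f), (g \o g'); split.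
- by move=> x; apply: continuous_comp; [exact: cf|exact: cf'].
- by move=> x; apply: continuous_comp; [exact: cg'|exact: cg].
- exact: can_comp.
- exact: can_comp.
Qed.

Section RealContinuity.
Context {R : realType} {T : topologicalType}.
Implicit Types f g : T -> R.

Lemma ctsC (a : R) : continuous (fun _ : T => a).
Proof. by move=> x; exact: cvg_cst. Qed.
Lemma ctsD f g : continuous f -> continuous g -> continuous (fun x => f x + g x).
Proof. by move=> cf cg x; exact: cvgD (cf x) (cg x). Qed.
Lemma ctsN f : continuous f -> continuous (fun x => - f x).
Proof. by move=> cf x; exact: cvgN (cf x). Qed.
Lemma ctsB f g : continuous f -> continuous g -> continuous (fun x => f x - g x).
Proof. by move=> cf cg; apply: ctsD => //; exact: ctsN. Qed.

Lemma cts_shift f (k : R) : continuous f -> continuous (fun x => f x - k).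
Proof. by move=> cf; apply: ctsD => //; exact: ctsC. Qed.

Lemma ctsM f g : continuous f -> continuous g -> continuous (fun x => f x * g x).
Proof. by move=> cf cg x; exact: cvgM (cf x) (cg x). Qed.
Lemma ctsV f : (forall x, f x != 0) -> continuous f -> continuous (fun x => (f x)^-1).
Proof. by move=> f0 cf x; exact: cvgV (f0 x) (cf x). Qed.
Lemma cts_min f g : continuous f -> continuous g -> continuous (fun x => Num.min (f x) (g x)).
Proof. by move=> cf cg x; apply: (@continuous_min _ _ f g); [exact: cf|exact: cg]. Qed.
Lemma cts_max f g : continuous f -> continuous g -> continuous (fun x => Num.max (f x) (g x)).
Proof. by move=> cf cg x; apply: (@continuous_max _ _ f g); [exact: cf|exact: cg]. Qed.
Lemma cts_norm f : continuous f -> continuous (fun x => `|f x|).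
Proof. by move=> cf x; exact: cvg_norm (cf x). Qed.
Lemma cts_pair (U V : topologicalType) (f : T -> U) (g : T -> V) : continuous f -> continuous g -> continuous (fun x => (f x, g x)).
Proof. by move=> cf cg x; exact: cvg_pair (cf x) (cg x). Qed.
Lemma cts_fst (U V : topologicalType) (f : T -> U * V) : continuous f -> continuous (fun x => (f x).1).
Proof. by move=> cf x; apply: continuous_comp (cf x) _; exact: cvg_fst. Qed.
Lemma cts_snd (U V : topologicalType) (f : T -> U * V) : continuous f -> continuous (fun x => (f x).2).
Proof. by move=> cf x; apply: continuous_comp (cf x) _; exact: cvg_snd. Qed.
End RealContinuity.

Lemma set_val_inj (T : Type) (A : set T) (x y : A) : set_val x = set_val y -> x = y.
Proof.
case: x y => [u uX] [v vX]; rewrite !set_valE /= => uv; move: uX vX; rewrite uv => uX vX.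
by congr exist; exact: bool_irrelevance.
Qed.

Section Subtype.
Context {X : topologicalType} {A : set X}.

Lemma set_val_continuous : continuous (set_val : A -> X).
Proof. exact: initial_continuous. Qed.

Lemma continuous_set_val (T : topologicalType) (f : T -> A) :
  continuous (set_val \o f) -> continuous f.
Proof.
move=> cf; apply/continuousP => B [C oC <-].
by rewrite -comp_preimage; move/continuousP: cf; apply.
Qed.

Lemma compact_set_type : compact A -> compact [set: A].
Proof.
move=> cA F FF _.
have FA : (set_val @ F) A by apply: nearW => x; exact: set_valP.
have [p [Ap clp]] := cA _ _ FA.
exists (exist _ p (mem_set Ap)); split=> // B U FB [_ [[W oW <-] Wp sWU]].
have : (set_val @ F) (set_val @` B) by apply: (@filterS _ F _ B) => // x Bx; exists x.
move=> /clp /(_ (open_nbhs_nbhs (conj oW Wp))) [_ [[y By <-] Wy]].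
by exists y; split=> //; exact: sWU.
Qed.

Lemma hausdorff_set_type : hausdorff_space X -> hausdorff_space A.
Proof.
move=> hX x y xy; apply: val_inj; apply: hX => U V Ux Vy.
have [z [Uz Vz]] := xy _ _ (set_val_continuous Ux) (set_val_continuous Vy).
by exists (set_val z).
Qed.
End Subtype.

Section Identification.
Context {X : topologicalType}.
Variable r : X -> X -> Prop.
Local Notation Q := (identification_space r).

Definition identify (x : X) : Q := (\pi_({eq_quot (glued_equiv r)}%qT) x)%qT.

Lemma identify_continuous : continuous identify.
Proof. exact: pi_continuous. Qed.

Lemma identify_surj (q : Q) : exists x, identify x = q.
Proof. by exists (repr (q : {eq_quot (glued_equiv r)}%qT)); rewrite /identify reprK. Qed.

Lemma identifyP x y : identify x = identify y <-> clos_refl_sym_trans X r x y.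
Proof.
split=> [/eqquotP /asboolP //|xy].
by apply/eqquotP/asboolP.
Qed.

Lemma open_identification (U : set Q) : open (identify @^-1` U) -> open U.
Proof. by []. Qed.

(** The inverse is continuous because f maps closed sets to compact, hence
closed, ones; saturation makes no difference since f is constant on classes. *)
Lemma compact_identification (Y : topologicalType) (f : X -> Y) :
  compact [set: X] -> hausdorff_space Y -> continuous f ->
  (forall x y, f x = f y <-> clos_refl_sym_trans X r x y) ->
  (forall y, exists x, f x = y) -> homeomorphic Q Y.
Proof.
move=> cX hY cf fP fS.
pose F (q : Q) : Y := f (repr (q : {eq_quot (glued_equiv r)}%qT)).
have FE x : F (identify x) = f x.
  by apply/fP/identifyP; rewrite /identify reprK.
have [g gK] := choice fS.
have FK : cancel F (identify \o g).
  move=> q; have [x <-] := identify_surj q.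
  by apply/identifyP/fP; rewrite gK FE.
exists F, (identify \o g); split => //.
- apply/quotient_continuous => x; rewrite (_ : F \o _ = f) //.
  by apply/funext => z; rewrite /= -[in RHS]FE.
- apply/continuousP => U oU; rewrite -[X in open X]setCK openC.
  rewrite preimage_setC.
  have -> : (identify \o g) @^-1` (~` U) = f @` (identify @^-1` (~` U)).
    rewrite eqEsubset; split=> [y /= hy|_ [x hx <-] /=].
      by exists (g y); rewrite ?gK.
    suff -> : identify (g (f x)) = identify x by [].
    by apply/identifyP/fP; rewrite gK.
  apply: compact_closed => //; apply: continuous_compact.
    exact: continuous_subspaceT.
  apply: subclosed_compact cX _ => //.
  by rewrite -preimage_setC closedC; exact: oU.
- by move=> y; rewrite /= FE gK.
Qed.
End Identification.

(** Needed for the exchange of the two degrees of freedom. *)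
Lemma homeomorphic_identification (X X' : topologicalType)
    (r : X -> X -> Prop) (r' : X' -> X' -> Prop) (f : X -> X') (g : X' -> X) :
  continuous f -> continuous g -> cancel f g -> cancel g f ->
  (forall x y, r x y -> r' (f x) (f y)) ->
  (forall x y, r' x y -> r (g x) (g y)) ->
  homeomorphic (identification_space r) (identification_space r').
Proof.
have lift (Y Z : topologicalType) (s : Y -> Y -> Prop) (s' : Z -> Z -> Prop) (k : Y -> Z) :
    continuous k -> (forall x y, s x y -> s' (k x) (k y)) ->
    exists K : identification_space s -> identification_space s',
      continuous K /\ forall x, K (identify s x) = identify s' (k x).
  move=> ck ks.
  have kss x y : clos_refl_sym_trans Y s x y -> clos_refl_sym_trans Z s' (k x) (k y).
    elim=> [{}x {}y /ks|{}x|{}x {}y _|{}x {}y z _ + _]; [exact: rst_step|exact: rst_refl|exact: rst_sym|exact: rst_trans].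
  pose K (q : identification_space s) := identify s' (k (repr (q : {eq_quot (glued_equiv s)}%qT))).
  have KE x : K (identify s x) = identify s' (k x).
    by apply/identifyP/kss/identifyP; rewrite /identify reprK.
  exists K; split=> //.
  apply/quotient_continuous => x; rewrite (_ : K \o _ = identify s' \o k).
    by apply: continuous_comp; [exact: ck|exact: identify_continuous].
  by apply/funext => z; rewrite /= -KE.
move=> cf cg fK gK rf rg.
have [F [cF FE]] := lift _ _ _ _ _ cf rf.
have [G [cG GE]] := lift _ _ _ _ _ cg rg.
exists F, G; split=> // q; have [x <-] := identify_surj q.
  by rewrite FE GE fK.
by rewrite GE FE gK.
Qed.

(** * A chart of a quarter of the surface *)

Section Charts.
Variable R : realFieldType.
Implicit Types (c d u v xi lam rho tau s x y z : R).

(** All the maps below are built from these two piecewise linear clamps. *)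
Definition ramp h x : R := Num.max 0 (Num.min x h).
Definition clip c x : R := Num.max (- c) (Num.min x c).

Variant ramp_spec (h x : R) : R -> Prop :=
| RampLow of x <= 0 : ramp_spec h x 0
| RampMid of 0 <= x & x <= h : ramp_spec h x x
| RampHigh of h <= x : ramp_spec h x h.

Lemma rampP h x : 0 <= h -> ramp_spec h x (ramp h x).
Proof.
move=> h0; rewrite /ramp; case: (leP x h) => [xh|/ltW hx].
  by case: (leP 0 x) => [x0|/ltW x0]; constructor.
by rewrite max_r //; constructor.
Qed.

Variant clip_spec (c x : R) : R -> Prop :=
| ClipLow of x <= - c : clip_spec c x (- c)
| ClipMid of - c <= x & x <= c : clip_spec c x x
| ClipHigh of c <= x : clip_spec c x c.

Lemma clipP c x : 0 <= c -> clip_spec c x (clip c x).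
Proof.
move=> c0; rewrite /clip; case: (leP x c) => [xc|/ltW cx].
  by case: (leP (- c) x) => [x0|/ltW x0]; constructor.
by rewrite max_r; [constructor|lra].
Qed.

(** A quarter of the surface consists of a corridor around the block of all the
holes (the outer walls, and the part of the top that surrounds the block) and
of the faces inside the block.  The block has half width c and, in the
quarter, height 1/2; in it a point is given by its abscissa xi from the
centre, its depth u below the upper side of the block (y = 2 - u) and its
depth v below the top (z = 1 - v).  K describes the inner faces, and inner
parametrizes them by the strip 0 <= d <= 1/2, -1 <= tau <= 1.  The rim d = 0
is the upper boundary of the block, run through at constant speed, along which
the corridor is attached. *)
Record inner_sheet (c : R) (K : R -> R -> R -> Prop)
    (inner : R -> R -> R * R * R) : Prop := InnerSheet {
  sheet_bound : forall xi u v, K xi u v ->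
    [/\ - c <= xi <= c, 0 <= u <= 1/2 & 0 <= v <= 1/2];
  sheet_in : forall d tau, 0 <= d <= 1/2 -> -1 <= tau <= 1 ->
    K (inner d tau).1.1 (inner d tau).1.2 (inner d tau).2;
  sheet_inj : forall d tau d' tau', 0 <= d <= 1/2 -> -1 <= tau <= 1 ->
    0 <= d' <= 1/2 -> -1 <= tau' <= 1 ->
    inner d tau = inner d' tau' -> d = d' /\ tau = tau';
  sheet_surj : forall xi u v, K xi u v ->
    exists d, exists tau, [/\ 0 <= d <= 1/2, -1 <= tau <= 1 &
      inner d tau = (xi, u, v)];
  sheet_rim : forall tau, inner 0 tau =
    (clip c ((c + 1/2) * tau), Num.max 0 (`|(c + 1/2) * tau| - c), 0) }.

(** The row rho <= 0 runs over the inner faces at d = - rho, the rows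
0 <= rho <= 1 over the top of the corridor, by enlarging the rim
proportionally until it reaches the outer boundary, and the rows
1 <= rho <= 3/2 down the outer walls. *)
Definition chart c (inner : R -> R -> R * R * R) (rho tau : R) : R * R * R :=
  let p := inner (Num.max 0 (- rho)) tau in
  let lam := ramp 1 rho in
  (c + 1 + (1 + lam / c) * p.1.1, 3/2 + (1 + 2 * lam) * (1/2 - p.1.2),
   1 - p.2 - Num.max 0 (rho - 1)).

(** The inequalities of the last disjunction say that the point is outside of
the block, and then it must lie on the top or on an outer wall. *)
Definition quarter c (K : R -> R -> R -> Prop) (s : R * R * R) : Prop :=
  let x := s.1.1 - (c + 1) in
  [/\ 3/2 <= s.1.2 <= 3, 1/2 <= s.2 <= 1, - (c + 1) <= x <= c + 1 &
   ([/\ - c <= x <= c, s.1.2 <= 2 & K x (2 - s.1.2) (1 - s.2)] \/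
    [/\ [\/ x < - c, c < x | 2 < s.1.2] &
        [\/ s.2 = 1, x = c + 1, x = - (c + 1) | s.1.2 = 3]])].

Section Chart.
Variables (c : R) (K : R -> R -> R -> Prop) (inner : R -> R -> R * R * R).
Hypotheses (c0 : 0 < c) (H : inner_sheet c K inner).
Local Notation F := (chart c inner).


Lemma chart_low rho tau : rho <= 0 ->
  let p := inner (- rho) tau in
  F rho tau = (c + 1 + p.1.1, 2 - p.1.2, 1 - p.2).
Proof.
move=> r0 /=; rewrite /chart; have -> : Num.max 0 (- rho) = - rho.
  by apply/max_idPr; lra.
have -> : ramp 1 rho = 0 by case: rampP => //; lra.
have -> : Num.max 0 (rho - 1) = 0 by apply/max_idPl; lra.
rewrite mul0r addr0 mul1r; congr (_, _, _); lra.
Qed.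

Lemma chart_high rho tau : 0 < rho -> 0 <= rho <= 3/2 -> -1 <= tau <= 1 ->
  exists lam w xi u, [/\ 0 < lam <= 1, 0 <= w <= 1/2, rho = lam + w /\ (w = 0 \/ lam = 1),
    [/\ - c <= xi <= c, 0 <= u <= 1/2, (xi = c \/ xi = - c) \/ u = 0 &
     inner 0 tau = (xi, u, 0)] &
    F rho tau = (c + 1 + (1 + lam / c) * xi, 3/2 + (1 + 2 * lam) * (1/2 - u), 1 - w)].
Proof.
move=> r0 /andP[_ r1] t1; rewrite /chart; have -> : Num.max 0 (- rho) = 0.
  by apply/max_idPl; lra.
have := @sheet_in _ _ _ H 0 tau; rewrite (sheet_rim H) => /= HK.
have {HK} /(sheet_bound H) [xiB uB _] : K (clip c ((c + 1 / 2) * tau))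
   (Num.max 0 (`|(c + 1 / 2) * tau| - c)) 0 by apply: HK => //; lra.
exists (ramp 1 rho), (Num.max 0 (rho - 1)), (clip c ((c + 1 / 2) * tau)),
  (Num.max 0 (`|(c + 1 / 2) * tau| - c)).
split.
- case: rampP => //; lra.
- by case: (leP 0 (rho - 1)) => ?; lra.
- case: rampP => // ?; case: (leP 0 (rho - 1)) => ?; split; first [lra | (left; lra) | (right; lra)].
- split => //.
  case: (leP 0 (`|(c + 1 / 2) * tau| - c)) => h; last by right.
  left; move: h; rewrite /clip; case: (ger0P ((c + 1 / 2) * tau)) => h1 h2.
    left; rewrite min_r; last by lra.
    by apply/max_idPr; lra.
  right; rewrite min_l; last by lra.
  by apply/max_idPl; lra.
- by rewrite subr0.
Qed.

Lemma widen_bound lam xi : 0 <= lam -> - c <= xi <= c ->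
  - (c + lam) <= (1 + lam / c) * xi <= c + lam.
Proof.
move=> l0 /andP[h1 h2].
have e : (1 + lam / c) * c = c + lam by field; rewrite gt_eqF.
have k0 : 0 <= 1 + lam / c by rewrite addr_ge0 // divr_ge0 // ltW.
by rewrite -e -mulrN !ler_wpM2l.
Qed.

Lemma widen_end lam : (1 + lam / c) * c = c + lam /\ (1 + lam / c) * (- c) = - c - lam.
Proof. by split; field; rewrite gt_eqF. Qed.

Lemma chart_in rho tau : - (1/2) <= rho <= 3/2 -> -1 <= tau <= 1 ->
  quarter c K (F rho tau).
Proof.
move=> rB tB; case: (leP rho 0) => r0.
  rewrite chart_low //=.
  have /(sheet_in H) /(_ tB) HK : 0 <= - rho <= 1/2 by lra.
  have [b1 b2 b3] := sheet_bound H HK.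
  split => /=; [lra|lra|lra|left; split; [lra|lra|]].
  have -> : c + 1 + (inner (- rho) tau).1.1 - (c + 1) = (inner (- rho) tau).1.1 by ring.
  have -> : 2 - (2 - (inner (- rho) tau).1.2) = (inner (- rho) tau).1.2 by ring.
  by have -> : 1 - (1 - (inner (- rho) tau).2) = (inner (- rho) tau).2 by ring.
have [|lam [w [xi [u [lB wB [rE lw] [xB uB xu _]] ->]]]] := @chart_high rho tau r0 _ tB.
  by lra.
have xb := @widen_bound lam xi ltac:(lra) xB.
have [e1 e2] := widen_end lam.
have yb : 0 <= (1 + 2 * lam) * (1/2 - u) <= 1/2 + lam by nra.
rewrite /quarter /=.
have -> : c + 1 + (1 + lam / c) * xi - (c + 1) = (1 + lam / c) * xi by ring.
split; [lra|lra|lra|right; split].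
  case: xu => [[->|->]|->].
  - by apply: Or32; rewrite e1; lra.
  - by apply: Or31; rewrite e2; lra.
  - by apply: Or33; lra.
case: lw => [->|lE]; first by apply: Or41; lra.
rewrite lE in e1 e2 *.
case: xu => [[->|->]|->].
- by apply: Or42; lra.
- by apply: Or43; lra.
- by apply: Or44; lra.
Qed.

(** The enlargement factor of the corridor can be read off the position, being
its distance to the block in a maximum norm; this gives the injectivity and
the preimages in the corridor. *)
Lemma chart_scale lam xi u : 0 < lam -> - c <= xi <= c -> 0 <= u <= 1/2 ->
  (xi = c \/ xi = - c) \/ u = 0 ->
  Num.max (`|(1 + lam / c) * xi| - c) (3/2 + (1 + 2 * lam) * (1/2 - u) - 2) = lam.
Proof.
move=> l0 xB uB xu.
have xb := @widen_bound lam xi ltac:(lra) xB.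
have [e1 e2] := widen_end lam.
have yb : 0 <= (1 + 2 * lam) * (1/2 - u) <= 1/2 + lam by nra.
have nb : `|(1 + lam / c) * xi| <= c + lam by rewrite ler_norml.
case: xu => [[xE|xE]|uE].
- by rewrite xE e1 ger0_norm; [apply/eqP; rewrite eq_le; apply/andP; split; rewrite ?ge_max ?le_max; lra | lra].
- by rewrite xE e2 ler0_norm; [apply/eqP; rewrite eq_le; apply/andP; split; rewrite ?ge_max ?le_max; lra | lra].
- apply/eqP; rewrite eq_le; apply/andP; split; rewrite ?ge_max ?le_max uE.
    by apply/andP; split; lra.
  by apply/orP; right; lra.
Qed.

Lemma chart_inj rho tau rho' tau' : - (1/2) <= rho <= 3/2 -> -1 <= tau <= 1 ->
  - (1/2) <= rho' <= 3/2 -> -1 <= tau' <= 1 ->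
  F rho tau = F rho' tau' -> rho = rho' /\ tau = tau'.
Proof.
have sep r t r' t' : - (1/2) <= r <= 3/2 -> -1 <= t <= 1 ->
  - (1/2) <= r' <= 3/2 -> -1 <= t' <= 1 -> r <= 0 -> 0 < r' -> F r t = F r' t' -> False.
  move=> rB tB rB' tB' r0 r0'; rewrite chart_low //.
  have /(sheet_in H) /(_ tB) /(sheet_bound H) [b1 b2 b3] : 0 <= - r <= 1/2 by lra.
  have [|lam [w [xi [u [lB wB [rE lw] [xB uB xu _]] ->]]]] := @chart_high r' t' r0' _ tB'.
    by lra.
  case=> xE yE _.
  have {}xE : (inner (- r) t).1.1 = (1 + lam / c) * xi by lra.
  have {}yE : (inner (- r) t).1.2 = 2 - (3/2 + (1 + 2 * lam) * (1/2 - u)) by lra.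
  have : Num.max (`|(1 + lam / c) * xi| - c) (3/2 + (1 + 2 * lam) * (1/2 - u) - 2) <= 0.
    by rewrite ge_max subr_le0 -xE ler_norml b1 /=; lra.
  by rewrite (@chart_scale lam xi u ltac:(lra) xB uB xu); lra.
move=> rB tB rB' tB' E.
case: (leP rho 0) => r0; case: (leP rho' 0) => r0'.
- move: E; rewrite !chart_low // => -[x y z].
  have {x y z} : inner (- rho) tau = inner (- rho') tau'.
    apply: injective_projections; last by lra.
    by apply: injective_projections; lra.
  by move/(sheet_inj H) => /(_ ltac:(lra) tB ltac:(lra) tB') [? ?]; split=> //; lra.
- by case: (sep _ _ _ _ rB tB rB' tB' r0 r0' E).
- by case: (sep _ _ _ _ rB' tB' rB tB r0' r0 (esym E)).
move: E.
have [|lam [w [xi [u [lB wB [rE lw] [xB uB xu iE]] ->]]]] := @chart_high rho tau r0 _ tB.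
  by lra.
have [|lam' [w' [xi' [u' [lB' wB' [rE' lw'] [xB' uB' xu' iE']] ->]]]] := @chart_high rho' tau' r0' _ tB'.
  by lra.
case=> xE yE zE.
have {}xE : (1 + lam / c) * xi = (1 + lam' / c) * xi' by lra.
have {}yE : (1 + 2 * lam) * (1/2 - u) = (1 + 2 * lam') * (1/2 - u') by lra.
have lE : lam = lam'.
  rewrite -(@chart_scale lam xi u ltac:(lra) xB uB xu).
  by rewrite -(@chart_scale lam' xi' u' ltac:(lra) xB' uB' xu') xE yE.
subst lam'; have wE : w = w' by lra.
have {}xE : xi = xi'.
  apply: (mulfI _ xE); rewrite gt_eqF // addr_gt0 // divr_gt0 //; lra.
have {}yE : u = u'.
  have : 1/2 - u = 1/2 - u' by apply: (mulfI _ yE); rewrite gt_eqF //; lra.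
  lra.
split; first by lra.
have : inner 0 tau = inner 0 tau' by rewrite iE iE' xE yE.
by move/(sheet_inj H) => /(_ ltac:(lra) tB ltac:(lra) tB') [].
Qed.

Lemma sheet_rim_surj xi u : - c <= xi <= c -> 0 <= u <= 1/2 ->
  (xi = c \/ xi = - c) \/ u = 0 ->
  exists2 tau, -1 <= tau <= 1 & inner 0 tau = (xi, u, 0).
Proof.
move=> xB uB xu.
(* arc length along the rim, from its middle *)
pose s := if u == 0 then xi else if xi == c then c + u else - c - u.
have sB : - (c + 1/2) <= s <= c + 1/2.
  by rewrite /s; case: ifP => _; [lra|case: ifP => _; lra].
exists (s / (c + 1/2)).
  by rewrite ler_pdivlMr ?ler_pdivrMr; lra.
rewrite (sheet_rim H).
have -> : (c + 1 / 2) * (s / (c + 1 / 2)) = s by field; lra.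
have [u0|u0] := eqVneq u 0.
  have sE : s = xi by rewrite /s u0 eqxx.
  rewrite sE u0 /clip; congr (_, _, _).
    by rewrite min_l ?max_r //; lra.
  by apply/max_idPl; rewrite subr_le0 ler_norml.
have [xE|xE] := eqVneq xi c.
  have sE : s = c + u by rewrite /s (negbTE u0) xE eqxx.
  rewrite sE xE /clip; congr (_, _, _).
    by rewrite min_r ?max_r //; lra.
  by rewrite ger0_norm ?max_r; lra.
have {}xE : xi = - c.
  by case: xu => [[e|//]|e]; [move: xE|move: u0]; rewrite e eqxx.
have sE : s = - c - u.
  have nc : - c < c by have := c0; lra.
  have {}nc : (- c == c) = false by exact: lt_eqF.

  by rewrite /s (negbTE u0) xE nc.
rewrite sE xE /clip; congr (_, _, _).
  by rewrite min_l ?max_l //; lra.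
by rewrite ler0_norm ?max_r; lra.
Qed.

Lemma chart_surj (pt : R * R * R) : quarter c K pt ->
  exists rho tau, [/\ - (1/2) <= rho <= 3/2, -1 <= tau <= 1 & F rho tau = pt].
Proof.
have := c0; case: pt => -[x y] z c0' [/= yB zB xB]; set X := x - (c + 1) in xB *.
case=> [[_ _ HK]|[out rim]].
  have [d [tau [dB tB E]]] := sheet_surj H HK.
  exists (- d), tau; split; [lra|lra|].
  rewrite chart_low ?opprK ?E /=; last by lra.
  by rewrite /X; congr (_, _, _); ring.
(* the point is on the rim enlarged by the distance lam to the block *)
pose lam := Num.max (`|X| - c) (y - 2).
have XB : `|X| <= c + 1 by rewrite ler_norml.
have l0 : 0 < lam.
  rewrite /lam; case: out => h; rewrite lt_max; apply/orP; [left|left|right]; last by lra.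
    by rewrite subr_gt0 ltr_normr; apply/orP; right; lra.
  by rewrite subr_gt0 ltr_normr; apply/orP; left; lra.
have l1 : lam <= 1 by rewrite /lam ge_max; apply/andP; split; lra.
have lX : `|X| <= c + lam by rewrite /lam -lerBlDl le_max lexx.
have ly : y - 2 <= lam by rewrite /lam le_max lexx orbT.
have lE : `|X| = c + lam \/ y = 2 + lam.
  by rewrite /lam; case: leP => h; [right|left]; lra.
have rimE : z = 1 \/ lam = 1.
  case: rim => h; [by left|right|right|right].
  - by have := lX; rewrite h ger0_norm; lra.
  - by have := lX; rewrite h ler0_norm; lra.
  - by lra.
have k0 : 0 < 1 + lam / c by rewrite addr_gt0 // divr_gt0.
have [e1 e2] := widen_end lam.
have [||| tau tB tE] := @sheet_rim_surj (X / (1 + lam / c)) (1/2 - (y - 3/2) / (1 + 2 * lam)).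
- move: lX; rewrite ler_norml => /andP[? ?].
  by rewrite ler_pdivlMr // ler_pdivrMr // mulrC e2 mulrC e1; lra.
- have : 0 <= (y - 3 / 2) / (1 + 2 * lam) <= 1/2.
    by rewrite ler_pdivlMr ?ler_pdivrMr; lra.
  by lra.
- case: lE => h; [left|right].
    have XE : X = c + lam \/ X = - c - lam by move: h; case: (ger0P X) => _ h; lra.
    case: XE => ->; [left|right].
      by rewrite -e1 mulrC mulKf // gt_eqF.
    by rewrite -e2 mulrC mulKf // gt_eqF.
  rewrite h; have -> : 2 + lam - 3/2 = 1/2 * (1 + 2 * lam) by field.
  by rewrite mulfK ?subrr // gt_eqF //; lra.
exists (lam + (1 - z)), tau; split => //; first by case: rimE; lra.
rewrite /chart.
have -> : Num.max 0 (- (lam + (1 - z))) = 0 by apply/max_idPl; lra.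
have -> : ramp 1 (lam + (1 - z)) = lam by case: rampP => // ?; case: rimE; lra.
have -> : Num.max 0 (lam + (1 - z) - 1) = 1 - z.
  by case: rimE => ?; [rewrite max_l|rewrite max_r]; lra.
rewrite tE /=.
have -> : (1 + lam / c) * (X / (1 + lam / c)) = X by rewrite mulrC mulfVK // gt_eqF.
rewrite /X; congr (_, _, _); first by ring.
  by field; lra.
by ring.
Qed.
End Chart.
End Charts.

(** * The faces around the holes, for one and two holes *)

Section Sheets.
Variable R : realFieldType.
Implicit Types (d u v xi tau a : R).

Definition inner_faces1 xi u v : Prop :=
  [/\ - (1/2) <= xi <= 1/2, 0 <= u <= 1/2, 0 <= v <= 1/2 &
      [\/ xi = 1/2, xi = - (1/2) | u = 0]].

Definition sheet1 d tau : R * R * R :=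
  (clip (1/2) tau, Num.max 0 (`|tau| - 1/2), d).

Variant sheet1_spec d tau : R * R * R -> Prop :=
| Sheet1Left of tau <= - (1/2) : sheet1_spec d tau (- (1/2), - tau - 1/2, d)
| Sheet1Mid of - (1/2) <= tau <= 1/2 : sheet1_spec d tau (tau, 0, d)
| Sheet1Right of 1/2 <= tau : sheet1_spec d tau (1/2, tau - 1/2, d).

Lemma sheet1P d tau : sheet1_spec d tau (sheet1 d tau).
Proof.
rewrite /sheet1 /clip; case: (leP tau (1/2)) => t1.
  case: (leP (- (1/2)) tau) => t2.
    have -> : Num.max 0 (`|tau| - 1/2) = 0.
      by apply/max_idPl; rewrite subr_le0 ler_norml t1 t2.
    by constructor; rewrite t1 t2.
  rewrite ler0_norm; last by lra.
  by rewrite max_r; [constructor|]; lra.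
rewrite max_r; last by lra.
by rewrite ger0_norm ?max_r; [constructor| |]; lra.
Qed.

(** With one hole the block is the hole itself; its three walls form a single
strip, on which d is the depth v below the top. *)
Lemma sheet1_inner : inner_sheet (1/2) inner_faces1 sheet1.
Proof.
split.
- by move=> xi u v [].
- move=> d tau dB tB; case: sheet1P => t; rewrite /inner_faces1 /=.
  + by split; [lra|lra|lra|apply: Or32].
  + by split; [lra|lra|lra|apply: Or33].
  + by split; [lra|lra|lra|apply: Or31].
- move=> d tau d' tau' dB tB dB' tB'.
  by case: sheet1P => t; case: sheet1P => t' [] *; split; lra.
- move=> xi u v [xB uB vB xu]; exists v.
  exists (if xi == 1/2 then 1/2 + u else if xi == - (1/2) then - (1/2) - u else xi).
  have [e|e] := eqVneq xi (1/2).
    split => //; first by lra.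
    case: sheet1P => t.
    + by exfalso; lra.
    + by rewrite e; congr (_, _, _); lra.
    + by rewrite e; congr (_, _, _); lra.
  have [e'|e'] := eqVneq xi (- (1/2)).
    split => //; first by lra.
    case: sheet1P => t.
    + by rewrite e'; congr (_, _, _); lra.
    + by rewrite e'; congr (_, _, _); lra.
    + by exfalso; lra.
  have u0 : u = 0 by case: xu => // h; [move: e|move: e']; rewrite h eqxx.
  split => //; first by lra.
  case: sheet1P => t.
  + by rewrite u0; congr (_, _, _); lra.
  + by rewrite u0.
  + by rewrite u0; congr (_, _, _); lra.
- move=> tau; rewrite /sheet1 (_ : 1/2 + 1/2 = 1) ?mul1r //; lra.
Qed.

Definition inner_faces2 xi u v : Prop :=
  [/\ - (3/2) <= xi <= 3/2, 0 <= u <= 1/2, 0 <= v <= 1/2 &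
      [\/ - (1/2) <= xi <= 1/2, xi = 3/2, xi = - (3/2) | u = 0] /\
      [\/ v = 0, 1/2 <= xi | xi <= - (1/2)]].

(** With two holes the block contains the leg between them.  At depth d the
row runs, from the middle outwards: across half of the leg at distance u = d
(length 1/2), over the leg's side wall (length 2d, since v grows from 0 to d
and then u decreases from d to 0), under the bar above the hole at v = d
(length 1) and down the outer wall of the hole (length 1/2).  The side wall
opens like a wedge at its corner with the bar, so the rows have half length
2 + 2d, and s is the arc length from the middle. *)
Definition sheet2 d tau : R * R * R :=
  let s := (2 + 2 * d) * tau in
  (clip (1/2) s + ramp 1 (s - 1/2 - 2 * d) - ramp 1 (- s - 1/2 - 2 * d),
   d - ramp d (`|s| - 1/2 - d) + Num.max 0 (`|s| - 3/2 - 2 * d),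
   ramp d (`|s| - 1/2)).

(** The right half of a row of sheet2, by the arc length a. *)
Variant profile_spec d a : R -> R -> R -> Prop :=
| ProfileLeg of 0 <= a <= 1/2 : profile_spec d a a d 0
| ProfileWall of 1/2 <= a <= 1/2 + d : profile_spec d a (1/2) d (a - 1/2)
| ProfileWall' of 1/2 + d <= a <= 1/2 + 2 * d :
    profile_spec d a (1/2) (1/2 + 2 * d - a) d
| ProfileBar of 1/2 + 2 * d <= a <= 3/2 + 2 * d :
    profile_spec d a (a - 2 * d) 0 d
| ProfileEnd of 3/2 + 2 * d <= a <= 2 + 2 * d :
    profile_spec d a (3/2) (a - 3/2 - 2 * d) d.

Definition signed (neg : bool) (x : R) := if neg then - x else x.

Variant sheet2_spec d tau : R * R * R -> Prop :=
| Sheet2 (neg : bool) a xi u v of signed neg a = (2 + 2 * d) * tau &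
    profile_spec d a xi u v : sheet2_spec d tau (signed neg xi, u, v).

Lemma sheet2P d tau : 0 <= d <= 1/2 -> -1 <= tau <= 1 ->
  sheet2_spec d tau (sheet2 d tau).
Proof.
move=> dB tB; rewrite /sheet2; set s := (2 + 2 * d) * tau.
have sB : - (2 + 2 * d) <= s <= 2 + 2 * d by rewrite /s; nra.
have half a : 0 <= a <= 2 + 2 * d -> profile_spec d a
   (clip (1/2) a + ramp 1 (a - 1/2 - 2 * d) - ramp 1 (- a - 1/2 - 2 * d))
   (d - ramp d (a - 1/2 - d) + Num.max 0 (a - 3/2 - 2 * d))
   (ramp d (a - 1/2)).
  move=> aB.
  have -> : ramp 1 (- a - 1/2 - 2 * d) = 0 by case: rampP => //; lra.
  rewrite subr0.
  have -> : clip (1/2) a = Num.min a (1/2).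
    by apply/max_idPr; rewrite le_min; apply/andP; split; lra.
  have R1 x : x <= 0 -> ramp 1 x = 0 by case: rampP => //; lra.
  have M0 (x : R) : x <= 0 -> Num.max 0 x = 0 by move=> ?; apply/max_idPl.
  have M1 (x : R) : 0 <= x -> Num.max 0 x = x by move=> ?; apply/max_idPr.
  have Dlow x : x <= 0 -> ramp d x = 0 by case: rampP; lra.
  have Dmid x : 0 <= x <= d -> ramp d x = x by case: rampP; lra.
  have Dhigh x : d <= x -> ramp d x = d by case: rampP; lra.
  have [h|h] := leP a (1/2).
    rewrite R1 ?(Dlow (a - 1/2 - d)) ?(Dlow (a - 1/2)) ?M0 ?addr0 ?subr0; try lra.
    by constructor; lra.
  have [h1|h1] := leP a (1/2 + d).
    rewrite R1 ?(Dlow (a - 1/2 - d)) ?(Dmid (a - 1/2)) ?M0 ?addr0 ?subr0; try lra.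
    by constructor; lra.
  have [h2|h2] := leP a (1/2 + 2 * d).
    rewrite R1 ?(Dmid (a - 1/2 - d)) ?(Dhigh (a - 1/2)) ?M0 ?addr0; try lra.
    rewrite (_ : d - _ = 1/2 + 2 * d - a); last by ring.
    by constructor; lra.
  rewrite (Dhigh (a - 1/2 - d)) ?(Dhigh (a - 1/2)) ?subrr ?add0r; try lra.
  have [h3|h3] := leP a (3/2 + 2 * d).
    have -> : ramp 1 (a - 1/2 - 2 * d) = a - 1/2 - 2 * d by case: rampP => //; lra.
    rewrite M0; last by lra.
    rewrite (_ : 1/2 + _ = a - 2 * d); last by ring.
    by constructor; lra.
  have -> : ramp 1 (a - 1/2 - 2 * d) = 1 by case: rampP => //; lra.
  rewrite M1; last by lra.
  rewrite (_ : 1/2 + 1 = 3/2); last by lra.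
  by constructor; lra.
case: (leP 0 s) => s0.
  by rewrite ger0_norm //; apply: (@Sheet2 _ _ false s) => //; apply: half; lra.
rewrite ltr0_norm //.
have /half : 0 <= - s <= 2 + 2 * d by lra.
set xi := (X in profile_spec _ _ X _ _) => hP.
have -> : clip (1/2) s + ramp 1 (s - 1/2 - 2 * d) - ramp 1 (- s - 1/2 - 2 * d) = signed true xi.
  rewrite /= /xi opprK.
  have -> : clip (1/2) (- s) = - clip (1/2) s.
    have hc : 0 <= 1/2 :> R by lra.
    by case: (clipP _ hc) => *; case: (clipP _ hc) => *; lra.
  by rewrite opprB opprD opprK addrA addrAC addrC addrA.
by apply: (@Sheet2 _ _ true (- s)) => //=; rewrite opprK.
Qed.

Lemma profile_bound d a xi u v : 0 <= d <= 1/2 -> profile_spec d a xi u v ->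
  [/\ 0 <= a <= 2 + 2 * d, 0 <= xi <= 3/2, 0 <= u <= 1/2, 0 <= v <= 1/2 &
      [\/ xi <= 1/2, xi = 3/2 | u = 0] /\ (v = 0 \/ 1/2 <= xi)].
Proof.
by move=> dB; case=> aB; split; (try lra); split;
  do ?[by left; lra | by right; lra | by apply: Or31; lra | by apply: Or32 | by apply: Or33].
Qed.

(** Both directions matter: the first is injectivity, the second says that the
profile is a function of (d, a) although its cases overlap. *)
Lemma profile_eq d a d' a' xi u v xi' u' v' : 0 <= d <= 1/2 -> 0 <= d' <= 1/2 ->
  profile_spec d a xi u v -> profile_spec d' a' xi' u' v' ->
  (xi, u, v) = (xi', u', v') <-> d = d' /\ a = a'.
Proof.
move=> dB dB' P P'; split.
  by case: P => ?; case: P' => ? [] *; split; lra.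
by case=> ? ?; case: P => ?; case: P' => ?; congr (_, _, _); lra.
Qed.

Lemma profile_surj xi u v : 0 <= xi <= 3/2 -> 0 <= u <= 1/2 -> 0 <= v <= 1/2 ->
  [\/ xi <= 1/2, xi = 3/2 | u = 0] -> v = 0 \/ 1/2 <= xi ->
  exists d a, [/\ 0 <= d <= 1/2, 0 <= a <= 2 + 2 * d & profile_spec d a xi u v].
Proof.
move=> xB uB vB xu vx.
have [x1|x1] := ltP xi (1/2).
  have v0 : v = 0 by case: vx => //; lra.
  by exists u, xi; rewrite v0; split; [lra|lra|constructor; lra].
have [xE|x2] := eqVneq xi (1/2).
  have [uv|uv] := leP v u.
    exists u, (1/2 + v); split; [lra|lra|].
    rewrite [X in profile_spec _ _ _ _ X](_ : v = 1/2 + v - 1/2); last by ring.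
    by rewrite xE; constructor; lra.
  exists v, (1/2 + 2 * v - u); split; [lra|lra|].
  rewrite [X in profile_spec _ _ _ X _](_ : u = 1/2 + 2 * v - (1/2 + 2 * v - u)); last by ring.
  by rewrite xE; constructor; lra.
have {}x1 : 1/2 < xi by rewrite lt_neqAle eq_sym x2.
have [xE|x3] := eqVneq xi (3/2).
  exists v, (3/2 + 2 * v + u); split; [lra|lra|].
  rewrite [X in profile_spec _ _ _ X _](_ : u = 3/2 + 2 * v + u - 3/2 - 2 * v); last by ring.
  by rewrite xE; constructor; lra.
have {}x3 : xi < 3/2 by rewrite lt_neqAle x3; lra.
have u0 : u = 0 by case: xu => // h; lra.
exists v, (xi + 2 * v); split; [lra|lra|].
rewrite [X in profile_spec _ _ X _ _](_ : xi = xi + 2 * v - 2 * v); last by ring.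
by rewrite u0; constructor; lra.
Qed.

Lemma signed_inj (n n' : bool) (x x' : R) : 0 <= x -> 0 <= x' -> signed n x = signed n' x' ->
  x = x' /\ (n = n' \/ x = 0).
Proof. by case: n; case: n' => /= ? ? ?; split; try lra; first [by left|right; lra]. Qed.

Lemma signed0 n : signed n 0 = 0.
Proof. by case: n; rewrite /= ?oppr0. Qed.

Lemma profile_origin d a xi u v : 0 <= d <= 1/2 -> profile_spec d a xi u v ->
  xi = 0 <-> a = 0.
Proof. by move=> dB; case=> ?; split => ?; lra. Qed.

Lemma sheet2_inner : inner_sheet (3/2) inner_faces2 sheet2.
Proof.
split.
- by move=> xi u v [].
- move=> d tau dB tB; case: (sheet2P dB tB) => n a xi u v sE /(profile_bound dB) /=.
  move=> [aB xB uB vB [h1 h2]]; split => //; first by case: n {sE} => /=; lra.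
  split.
    case: h1 => h1; [apply: Or41|case: n {sE}; [apply: Or43|apply: Or42]|apply: Or44] => //.
      by case: n {sE} => /=; lra.
    by rewrite /= h1.
  by case: h2 => h2; [apply: Or31|case: n {sE} => /=; [apply: Or33|apply: Or32]] => //; lra.
- move=> d tau d' tau' dB tB dB' tB'.
  case: (sheet2P dB tB) => n a xi u v sE P; case: (sheet2P dB' tB') => n' a' xi' u' v' sE' P'.
  move=> E.
  have [aB xB _ _ _] := profile_bound dB P.
  have [aB' xB' _ _ _] := profile_bound dB' P'.
  have [xE nE] : xi = xi' /\ (n = n' \/ xi = 0).
    by case: E => /signed_inj H _ _; apply: H; lra.
  have [dE aE] : d = d' /\ a = a'.
    by apply/(profile_eq dB dB' P P'); case: E => _ -> ->; rewrite xE.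
  split => //; subst d'.
  apply: (@mulfI _ (2 + 2 * d)); first by rewrite gt_eqF //; lra.
  rewrite -sE -sE' -aE; case: nE => [->//|/(profile_origin dB P) ->].
  by rewrite !signed0.
- move=> xi u v [xB uB vB [h1 h2]].
  pose n := xi < 0; have xE : xi = signed n `|xi|.
    by rewrite /n; case: ltP => h /=; [rewrite ltr0_norm // opprK|rewrite ger0_norm].
  have [|||d [a [dB aB P]]] := @profile_surj `|xi| u v _ uB vB _ _.
  + by rewrite normr_ge0 ler_norml.
  + case: h1 => h1; [apply: Or31; rewrite ler_norml //|apply: Or32|apply: Or32|apply: Or33 => //].
      by rewrite h1 ger0_norm; lra.
    by rewrite h1 ler0_norm; lra.
  + case: h2 => h2; [by left|right|right]; rewrite ler_normr; apply/orP; [left|right]; lra.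
  have dp : 0 < 2 + 2 * d by lra.
  exists d, (signed n a / (2 + 2 * d)).
  have tB : -1 <= signed n a / (2 + 2 * d) <= 1.
    by rewrite ler_pdivlMr // ler_pdivrMr //; case: (n) => /=; lra.
  split => //.
  case: (sheet2P dB tB) => n' a' xi' u' v'.
  rewrite mulrC divfK ?gt_eqF // => sE P'.
  have [aB' xB' _ _ _] := profile_bound dB P'.
  have [aE nE] : a' = a /\ (n' = n \/ a' = 0) by apply: signed_inj; lra.
  have [xE' -> ->] : (xi', u', v') = (`|xi|, u, v).
    by apply/(profile_eq dB dB P' P).
  congr (_, _, _); rewrite xE -xE'; case: nE => [->//|/(profile_origin dB P')->].
  by rewrite !signed0.
- move=> tau; rewrite /sheet2 mulr0 addr0 (_ : 3/2 + 1/2 = 2 :> R); last by lra.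
  set s := 2 * tau; have R0 (x : R) : ramp 0 x = 0 by case: rampP => //; lra.
  rewrite !R0 !subr0 add0r; congr (_, _, _).
  have hc : 0 <= 1/2 :> R by lra.
  have hc' : 0 <= 3/2 :> R by lra.
  have h1 : 0 <= 1 :> R by lra.
  by case: (clipP _ hc) => *; case: (rampP _ h1) => *; case: (rampP _ h1) => *;
     case: (clipP _ hc') => *; lra.
Qed.

(** Only the outer walls and the inner faces come down to z = 1/2, and the
enlargement of the corridor fixes the line y = 3/2. *)
Lemma chart_edges c K inner rho tau : 0 < c -> inner_sheet c K inner ->
  - (1/2) <= rho <= 3/2 -> -1 <= tau <= 1 ->
  ((chart c inner rho tau).2 = 1/2 <->
     rho = 3/2 \/ (inner (Num.max 0 (- rho)) tau).2 = 1/2) /\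
  ((chart c inner rho tau).1.2 = 3/2 <-> (inner (Num.max 0 (- rho)) tau).1.2 = 1/2).
Proof.
move=> c0 H rB tB; rewrite /chart /=.
have lB : 0 <= ramp 1 rho by case: rampP => //; lra.
split; last first.
  split=> [h|->]; last by rewrite subrr mulr0 addr0.
  suff : 1/2 - (inner (Num.max 0 (- rho)) tau).1.2 = 0 by lra.
  apply: (@mulfI _ (1 + 2 * ramp 1 rho)); first by rewrite gt_eqF //; lra.
  by rewrite mulr0; lra.
have [r0|r0] := leP rho 0.
  have -> : Num.max 0 (rho - 1) = 0 by apply/max_idPl; lra.
  by split=> [?|[?|?]]; [right|exfalso|]; lra.
have -> : Num.max 0 (- rho) = 0 by apply/max_idPl; lra.
rewrite (sheet_rim H) /=.
case: (leP 0 (rho - 1)) => ?; split=> [?|[?|?]]; first [by left; lra|exfalso; lra|lra].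
Qed.

Lemma chart1_edges rho tau : - (1/2) <= rho <= 3/2 -> -1 <= tau <= 1 ->
  ((chart (1/2) sheet1 rho tau).2 = 1/2 <-> rho = - (1/2) \/ rho = 3/2) /\
  ((chart (1/2) sheet1 rho tau).1.2 = 3/2 <-> tau = -1 \/ tau = 1).
Proof.
move=> rB tB; have h0 : 0 < 1/2 :> R by lra.
have [E1 E2] := chart_edges h0 sheet1_inner rB tB.
split; [apply: (iff_trans E1)|apply: (iff_trans E2)].
  by rewrite /=; case: (leP 0 (- rho)) => ?; split=> -[?|?];
    first [by left; lra|by right; lra|exfalso; lra].
by case: sheet1P => t /=; split=> [?|[?|?]];
  first [lra|by left; lra|by right; lra|exfalso; lra].
Qed.

Lemma profile_edges d a xi u v : 0 <= d <= 1/2 -> profile_spec d a xi u v ->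
  (v = 1/2 <-> d = 1/2 /\ 1 <= a) /\
  (u = 1/2 <-> a = 2 + 2 * d \/ (d = 1/2 /\ a <= 1)).
Proof.
move=> dB; case=> aB; split; (split; [move=> h|]).
all: try (by case=> ? ?; lra).
all: try (by split; lra).
all: try (by exfalso; lra).
all: try (by case=> [?|[? ?]]; lra).
all: try (by left; lra).
all: try (by right; split; lra).
Qed.

Lemma signed_marks n d a tau : 0 <= a -> 0 <= d -> signed n a = (2 + 2 * d) * tau ->
  [/\ a = 2 + 2 * d <-> tau = -1 \/ tau = 1,
      d = 1/2 -> 1 <= a <-> tau <= - (1/3) \/ 1/3 <= tau &
      d = 1/2 -> a <= 1 <-> - (1/3) <= tau <= 1/3].
Proof.
move=> a0 d0 aE; have d1 : 2 + 2 * d != 0 by rewrite gt_eqF //; lra.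
split.
- split=> [h|[h|h]].
  + have /(mulfI d1) <- : (2 + 2 * d) * signed n 1 = (2 + 2 * d) * tau.
      by rewrite -aE h; case: (n) => /=; ring.
    by case: (n); [left|right].
  + by move: aE; rewrite h; case: (n) => /= ?; lra.
  + by move: aE; rewrite h; case: (n) => /= ?; lra.
- move=> h; move: aE; rewrite h => aE; split; case: n aE => /= aE.
  + by move=> ?; left; lra.
  + by move=> ?; right; lra.
  + by case=> ?; lra.
  + by case=> ?; lra.
- by move=> h; move: aE; rewrite h; case: (n) => /= ?; split=> ?; lra.
Qed.

(** The bottom row is divided in thirds: the middle third is the lower edge of
the leg, in the plane y = 3/2, and the outer ones border the two holes. *)
Lemma chart2_edges rho tau : - (1/2) <= rho <= 3/2 -> -1 <= tau <= 1 ->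
  ((chart (3/2) sheet2 rho tau).2 = 1/2 <->
     rho = 3/2 \/ (rho = - (1/2) /\ (tau <= - (1/3) \/ 1/3 <= tau))) /\
  ((chart (3/2) sheet2 rho tau).1.2 = 3/2 <->
     (tau = -1 \/ tau = 1) \/ (rho = - (1/2) /\ - (1/3) <= tau <= 1/3)).
Proof.
move=> rB tB; have h0 : 0 < 3/2 :> R by lra.
have [E1 E2] := chart_edges h0 sheet2_inner rB tB.
set d := Num.max 0 (- rho) in E1 E2.
have dB : 0 <= d <= 1/2 by rewrite /d; case: (leP 0 (- rho)) => ?; lra.
have dE : d = 1/2 <-> rho = - (1/2) by rewrite /d; case: (leP 0 (- rho)) => ?; split => ?; lra.
move: E1 E2; case: (sheet2P dB tB) => n a xi u v aE P /= E1 E2.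
have [/andP[a0 _] _ _ _ _] := profile_bound dB P.
have [F1 F2] := profile_edges dB P.
have /andP[d0 _] := dB.
have [M1 M2 M3] := signed_marks a0 d0 aE.
split; [apply: (iff_trans E1)|apply: (iff_trans E2)].
  rewrite F1; split=> -[h|[h h']]; [by left|right|by left|right].
    by split; [exact/dE|exact/(M2 h)].
  by move/dE in h; split=> //; exact/(M2 h).
rewrite F2; split=> -[h|[h h']]; [left|right|left|right].
- exact/M1.
- by split; [exact/dE|exact/(M3 h)].
- exact/M1.
- by move/dE in h; split=> //; exact/(M3 h).
Qed.
End Sheets.

(** * The standard surfaces of genus one and two *)

Section Surface.
Variable R : realType.
Implicit Types s : R * R * R.

Definition at_rim (g : nat) s : Prop :=
  [\/ s.1.1 = 0 \/ s.1.1 = (2 * g + 1)%:R, s.1.2 = 0 \/ s.1.2 = 3,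
      s.2 = 0 \/ s.2 = 1 |
      exists2 k : nat, (k < g)%N &
        (2 * k + 1)%:R <= s.1.1 <= (2 * k + 2)%:R /\ 1 <= s.1.2 <= 2].

(** A point is shown not to be interior by moving straight to a point v such
that all of the segment but its origin is outside. *)
Lemma interior_segment (S : set (R * R * R)) s v : interior S s ->
  exists2 t : R, 0 < t <= 1 &
    S (s.1.1 + t * (v.1.1 - s.1.1), s.1.2 + t * (v.1.2 - s.1.2), s.2 + t * (v.2 - s.2)).
Proof.
move=> iS.
pose f (t : R) := (s.1.1 + t * (v.1.1 - s.1.1), s.1.2 + t * (v.1.2 - s.1.2),
   s.2 + t * (v.2 - s.2)).
have lin (a b : R) : continuous (fun t : R => a + t * b).
  by apply: ctsD; [exact: ctsC|apply: ctsM; [move=> ?|exact: ctsC]].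
have cf : continuous f.
  by apply: cts_pair; [apply: cts_pair|]; exact: lin.
have f0 : f 0 = s by rewrite /f !mul0r !addr0 -!surjective_pairing.
have /nbhs_ballP [e /= e0 eS] : nbhs (0 : R) (f @^-1` S) by apply: cf; rewrite f0.
exists (Num.min 1 (e / 2)).
  by rewrite ge_min lexx lt_min ltr01 divr_gt0.
apply: eS; rewrite /ball /= sub0r normrN ger0_norm.
  by rewrite gt_min; apply/orP; right; lra.
by rewrite le_min ler01 ltW // divr_gt0.
Qed.

Lemma near_lt (T : topologicalType) (f : T -> R) (x : T) (c : R) :
  {for x, continuous f} -> f x < c -> \forall u \near x, f u < c.
Proof. by move=> cf fx; apply: (@cvgr_lt _ _ (nbhs x) _ f (f x)). Qed.

Lemma near_gt (T : topologicalType) (f : T -> R) (x : T) (c : R) :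
  {for x, continuous f} -> c < f x -> \forall u \near x, c < f u.
Proof. by move=> cf fx; apply: (@cvgr_gt _ _ (nbhs x) _ f (f x)). Qed.

Lemma standard_surfaceP (g : nat) s :
  standard_surface g s <-> pierced_slab g s /\ at_rim g s.
Proof.
have cx : continuous (fun u : R * R * R => u.1.1).
  by apply/cts_fst/cts_fst => ?; exact: cvg_id.
have cy : continuous (fun u : R * R * R => u.1.2).
  by apply/cts_snd/cts_fst => ?; exact: cvg_id.
have cz : continuous (fun u : R * R * R => u.2).
  by apply/cts_snd => ?; exact: cvg_id.
split=> -[sS sI]; split=> //; last first.
  move=> /interior_segment iS; case: sI => [[E|E]|[E|E]|[E|E]|[k kg [xk yk]]].
  - have [t t0 [h _ _ _]] := iS (-1, s.1.2, s.2); move: h; rewrite /= E; lra.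
  - have [t t0 [h _ _ _]] := iS (s.1.1 + 1, s.1.2, s.2); move: h; rewrite /= E; lra.
  - have [t t0 [_ h _ _]] := iS (s.1.1, -1, s.2); move: h; rewrite /= E; lra.
  - have [t t0 [_ h _ _]] := iS (s.1.1, 4, s.2); move: h; rewrite /= E; lra.
  - have [t t0 [_ _ h _]] := iS (s.1.1, s.1.2, -1); move: h; rewrite /= E; lra.
  - have [t t0 [_ _ h _]] := iS (s.1.1, s.1.2, 2); move: h; rewrite /= E; lra.
  have [t t0 [_ _ _ /(_ k kg) /=]] := iS ((2 * k)%:R + 3/2, 3/2, s.2); apply.
  by move: xk; rewrite !natrD; move: ((2 * k)%:R : R) => K xk; split; nra.
apply: contrapT => nr; apply: sI.
case: sS => xB yB zB hB.
have [/andP[x0 x1] [/andP[y0 y1] /andP[z0 z1]]] :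
   0 < s.1.1 < (2 * g + 1)%:R /\ 0 < s.1.2 < 3 /\ 0 < s.2 < 1.
  do ?split; rewrite !lt_neqAle; apply/andP; split; apply/andP; split; try lra;
    apply/eqP => e; apply: nr;
    [apply: Or41; left|apply: Or41; right|apply: Or42; left|apply: Or42; right
    |apply: Or43; left|apply: Or43; right] => //; by rewrite -e.
have holes : \forall u \near s, forall k : 'I_g,
    ~ ((2 * k + 1)%:R < u.1.1 < (2 * k + 2)%:R /\ 1 < u.1.2 < 2).
  apply: (@filter_forall _ _ (fun (k : 'I_g) (u : R * R * R) =>
    ~ ((2 * k + 1)%:R < u.1.1 < (2 * k + 2)%:R /\ 1 < u.1.2 < 2)) (nbhs s)) => k.
  have [h|h] := ltP s.1.1 (2 * k + 1)%:R.
    by apply: filterS (near_lt (cx s) h) => u h1 [h2 _]; lra.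
  have [h'|h'] := ltP (2 * k + 2)%:R s.1.1.
    by apply: filterS (near_gt (cx s) h') => u h1 [h2 _]; lra.
  have [h2|h2] := ltP s.1.2 1.
    by apply: filterS (near_lt (cy s) h2) => u h1 [_ h3]; lra.
  have [h3|h3] := ltP 2 s.1.2.
    by apply: filterS (near_gt (cy s) h3) => u h1 [_ h4]; lra.
  exfalso; apply: nr; apply: Or44; exists k => //.
  by split; apply/andP.
near=> u; split.
- apply/andP; split; apply: ltW; near: u; [exact: (near_gt (cx s) x0)|exact: (near_lt (cx s) x1)].
- apply/andP; split; apply: ltW; near: u; [exact: (near_gt (cy s) y0)|exact: (near_lt (cy s) y1)].
- apply/andP; split; apply: ltW; near: u; [exact: (near_gt (cz s) z0)|exact: (near_lt (cz s) z1)].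
- near: u; apply: filterS holes => u H k kg; exact: (H (Ordinal kg)).
Unshelve. all: by end_near. Qed.

Lemma surface1P s : standard_surface 1 s <->
  [/\ 0 <= s.1.1 <= 3, 0 <= s.1.2 <= 3, 0 <= s.2 <= 1 &
      ~ (1 < s.1.1 < 2 /\ 1 < s.1.2 < 2)] /\
  [\/ s.1.1 = 0 \/ s.1.1 = 3, s.1.2 = 0 \/ s.1.2 = 3, s.2 = 0 \/ s.2 = 1 |
      1 <= s.1.1 <= 2 /\ 1 <= s.1.2 <= 2].
Proof.
split.
  case/standard_surfaceP => -[xB yB zB hB] h; split; first by split => //; exact: (hB 0%N).
  by case: h => [?|?|?|[[|//] _ ?]]; [apply: Or41|apply: Or42|apply: Or43|apply: Or44].
case=> -[xB yB zB hB] h; apply/standard_surfaceP; split; first by split => //; case.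
case: h => h; [apply: Or41|apply: Or42|apply: Or43|apply: Or44] => //.
by exists 0%N.
Qed.

Lemma surface2P s : standard_surface 2 s <->
  [/\ 0 <= s.1.1 <= 5, 0 <= s.1.2 <= 3, 0 <= s.2 <= 1 &
      ~ ((1 < s.1.1 < 2 \/ 3 < s.1.1 < 4) /\ 1 < s.1.2 < 2)] /\
  [\/ s.1.1 = 0 \/ s.1.1 = 5, s.1.2 = 0 \/ s.1.2 = 3, s.2 = 0 \/ s.2 = 1 |
      (1 <= s.1.1 <= 2 \/ 3 <= s.1.1 <= 4) /\ 1 <= s.1.2 <= 2].
Proof.
split.
  case/standard_surfaceP => -[xB yB zB hB] h; split.
    split => // -[[h1|h1] h2]; [exact: (hB 0%N)|exact: (hB 1%N)].
  case: h => [?|?|?|[[|[|//]] _ [? ?]]]; [apply: Or41|apply: Or42|apply: Or43|apply: Or44|apply: Or44] => //.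
    by split=> //; left.
  by split=> //; right.
case=> -[xB yB zB hB] h; apply/standard_surfaceP; split.
  split => //; case=> [_ [? ?]|[|//] _ [? ?]]; apply: hB; split=> //; [by left|by right].
case: h => [h|h|h|[[h|h] h']]; [apply: Or41|apply: Or42|apply: Or43|apply: Or44|apply: Or44] => //.
  by exists 0%N.
by exists 1%N.
Qed.

Definition mirror_y s : R * R * R := (s.1.1, 3 - s.1.2, s.2).
Definition mirror_z s : R * R * R := (s.1.1, s.1.2, 1 - s.2).

Lemma standard_surface_mirror_z g s : standard_surface g s -> standard_surface g (mirror_z s).
Proof.
move=> /standard_surfaceP [[xB yB zB hB] h]; apply/standard_surfaceP; split.
  by split => //=; lra.
case: h => [?|?|[?|?]|?]; [exact: Or41|exact: Or42|apply: Or43|apply: Or43|exact: Or44].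
  by right => /=; lra.
by left => /=; lra.
Qed.

Lemma standard_surface_mirror_y g s : standard_surface g s -> standard_surface g (mirror_y s).
Proof.
move=> /standard_surfaceP [[xB yB zB hB] h]; apply/standard_surfaceP; split.
  split => //=; first by lra.
  by move=> k kg [h1 h2]; apply: (hB k kg); split => //; lra.
case: h => [?|[?|?]|?|[k kg [h1 h2]]]; [exact: Or41|apply: Or42|apply: Or42|exact: Or43|apply: Or44].
- by right => /=; lra.
- by left => /=; lra.
- by exists k => //; split => //=; lra.
Qed.

(** The block of the holes is 1 <= x <= 2, y <= 2. *)
Lemma surface1_quarter s : 3/2 <= s.1.2 -> 1/2 <= s.2 ->
  (standard_surface 1 s <-> quarter (1/2) (@inner_faces1 R) s).
Proof.
case: s => -[x y] z /= y0 z0; rewrite /quarter /inner_faces1 /=.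
apply: (iff_trans (surface1P _)) => /=; split.
  case=> -[xB yB zB hB] h.
  split; [lra|lra|lra|].
  have [x1|x1] := ltP x 1.
    right; split; first by apply: Or31; lra.
    by case: h => [[?|?]|[?|?]|[?|?]|[? ?]]; first [exfalso; lra|apply: Or41; lra|apply: Or42; lra|apply: Or43; lra|apply: Or44; lra].
  have [x2|x2] := ltP 2 x.
    right; split; first by apply: Or32; lra.
    by case: h => [[?|?]|[?|?]|[?|?]|[? ?]]; first [exfalso; lra|apply: Or41; lra|apply: Or42; lra|apply: Or43; lra|apply: Or44; lra].
  have [y2|y2] := ltP 2 y.
    right; split; first by apply: Or33; lra.
    by case: h => [[?|?]|[?|?]|[?|?]|[? ?]]; first [exfalso; lra|apply: Or41; lra|apply: Or42; lra|apply: Or43; lra|apply: Or44; lra].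
  left; split; [lra|lra|split; [lra|lra|lra|]].
  have [xE|xE] := eqVneq x 1; first by apply: Or32; lra.
  have [xE'|xE'] := eqVneq x 2; first by apply: Or31; lra.
  have {}x1 : 1 < x by rewrite lt_neqAle eq_sym xE.
  have {}x2 : x < 2 by rewrite lt_neqAle xE'.
  by apply: Or33; have [?|?] := ltP y 2; [exfalso; apply: hB; split|]; lra.
case=> yB zB xB [[xB' y2 [_ uB vB h]]|[out rim]]; split.
- by split; (try lra) => -[? ?]; case: h => ?; lra.
- by apply: Or44; split; lra.
- by split; (try lra) => -[? ?]; case: out => ?; lra.
- by case: rim => ?; [apply: Or43; lra|apply: Or41; lra|apply: Or41; lra|apply: Or42; lra].
Qed.

(** The block of the holes is 1 <= x <= 4, y <= 2. *)
Lemma surface2_quarter s : 3/2 <= s.1.2 -> 1/2 <= s.2 ->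
  (standard_surface 2 s <-> quarter (3/2) (@inner_faces2 R) s).
Proof.
case: s => -[x y] z /= y0 z0; rewrite /quarter /inner_faces2 /=.
apply: (iff_trans (surface2P _)) => /=; split.
  case=> -[xB yB zB hB] h.
  split; [lra|lra|lra|].
  have rim : x < 1 \/ 4 < x \/ 2 < y -> [\/ z = 1, x - (3 / 2 + 1) = 3/2 + 1,
      x - (3 / 2 + 1) = - (3 / 2 + 1) | y = 3].
    move=> out; case: h => [[?|?]|[?|?]|[?|?]|[? ?]]; [apply: Or43|apply: Or42| |apply: Or44| |apply: Or41|]; lra.
  have [x1|x1] := ltP x 1.
    by right; split; [apply: Or31; lra|apply: rim; left].
  have [x2|x2] := ltP 4 x.
    by right; split; [apply: Or32; lra|apply: rim; right; left].
  have [y2|y2] := ltP 2 y.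
    by right; split; [apply: Or33; lra|apply: rim; right; right].
  left; split; [lra|lra|split; [lra|lra|lra|split]].
    have [yE|yE] := eqVneq y 2; first by apply: Or44; lra.
    have {}y2 : y < 2 by rewrite lt_neqAle yE.
    have [xE|xE] := eqVneq x 1; first by apply: Or43; lra.
    have [xE'|xE'] := eqVneq x 4; first by apply: Or42; lra.
    have {}x1 : 1 < x by rewrite lt_neqAle eq_sym xE.
    have {}x2 : x < 4 by rewrite lt_neqAle xE'.
    apply: Or41; have [x3|x3] := ltP x 2.
      by exfalso; apply: hB; split; [left|]; lra.
    have [x4|x4] := ltP 3 x.
      by exfalso; apply: hB; split; [right|]; lra.
    by lra.
  case: h => [[?|?]|[?|?]|[?|?]|[[?|?] ?]]; first [exfalso; lra|apply: Or31; lra|apply: Or32; lra|apply: Or33; lra].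
case=> yB zB xB [[xB' y2 [_ uB vB [h1 h2]]]|[out rim]]; split.
- by split; (try lra) => -[[?|?] ?]; case: h1 => ?; lra.
- case: h2 => h2; [apply: Or43; lra|apply: Or44..].
    by split; [right|]; lra.
  by split; [left|]; lra.
- by split; (try lra) => -[[?|?] ?]; case: out => ?; lra.
- by case: rim => ?; [apply: Or43; lra|apply: Or41; lra|apply: Or41; lra|apply: Or42; lra].
Qed.
End Surface.

(** * Spaces doubled by two reflections *)

(** Choosing the copy of the quarter by the sign of a momentum is continuous,
since the copies meet where the momentum vanishes. *)
Lemma cts_sg (R : realType) (T : topologicalType) (p f : T -> R) :
  continuous p -> continuous f -> (forall x, p x = 0 -> f x = 0) ->
  continuous (fun x => Num.sg (p x) * f x).
Proof.
move=> cp cf pf x; rewrite /continuous_at; have [p0|p0|p0] := ltgtP (p x) 0.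
- rewrite ltr0_sg // mulN1r; apply: cvg_trans (cvgN (cf x)).
  apply: near_eq_cvg; apply: filterS (near_lt (cp x) p0) => y py.
  by rewrite ltr0_sg // mulN1r.
- rewrite gtr0_sg // mul1r; apply: cvg_trans (cf x).
  apply: near_eq_cvg; apply: filterS (near_gt (cp x) p0) => y py.
  by rewrite gtr0_sg // mul1r.
- have f0 := pf _ p0; rewrite f0 mulr0; apply/cvgr0Pnorm_lt => e e0.
  have cn : {for x, continuous (fun y => `|f y|)} by exact: (cts_norm cf).
  have : `|f x| < e by rewrite f0 normr0.
  move=> /(near_lt cn); apply: filterS => y; apply: le_lt_trans.
  by rewrite normrM normr_sg; case: (_ != 0); rewrite ?mul1r // mul0r.
Qed.

(** X is the doubled space before identification: R1 and R2 exchange the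
copies, p1 and p2 are the quantities whose signs tell them apart, and F is the
projection to the quarter y >= 3/2, z >= 1/2 of the surface. *)
Section Doubling.
Variables (R : realType) (g : nat) (X : topologicalType) (r : X -> X -> Prop).
Variables (R1 R2 : X -> X) (p1 p2 : X -> R) (F : X -> R * R * R).
Hypotheses (cX : compact [set: X]) (cF : continuous F)
  (cp1 : continuous p1) (cp2 : continuous p2).
Hypothesis F_in : forall x,
  [/\ standard_surface g (F x), 3/2 <= (F x).1.2 & 1/2 <= (F x).2].
Hypothesis F_surj : forall s, standard_surface g s -> 3/2 <= s.1.2 -> 1/2 <= s.2 ->
  exists x, F x = s.
Hypotheses (p1_0 : forall x, p1 x = 0 -> (F x).2 = 1/2)
  (p2_0 : forall x, p2 x = 0 -> (F x).1.2 = 3/2).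
Hypotheses (R1E : forall x, [/\ F (R1 x) = F x, p1 (R1 x) = - p1 x & p2 (R1 x) = p2 x])
  (R2E : forall x, [/\ F (R2 x) = F x, p2 (R2 x) = - p2 x & p1 (R2 x) = p1 x]).
Hypothesis F_inj : forall x y, F x = F y ->
  [/\ p1 x = p1 y \/ p1 x = - p1 y, p2 x = p2 y \/ p2 x = - p2 y &
      p1 x = p1 y -> p2 x = p2 y -> x = y].
Hypothesis rE : forall x y, r x y ->
  ((F x).2 = 1/2 /\ y = R1 x) \/ ((F x).1.2 = 3/2 /\ y = R2 x).
Hypotheses (r1 : forall x, (F x).2 = 1/2 -> clos_refl_sym_trans X r x (R1 x))
  (r2 : forall x, (F x).1.2 = 3/2 -> clos_refl_sym_trans X r x (R2 x)).

Definition reflected_chart (x : X) : R * R * R :=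
  ((F x).1.1, 3/2 + Num.sg (p2 x) * ((F x).1.2 - 3/2),
   1/2 + Num.sg (p1 x) * ((F x).2 - 1/2)).

Lemma sg_cases (p a : R) : (p = 0 -> a = 0) ->
  Num.sg p * a = a \/ Num.sg p * a = - a.
Proof.
move=> pa; case: (ltgtP p 0) => [h|h|/pa ->].
- by right; rewrite ltr0_sg // mulN1r.
- by left; rewrite gtr0_sg // mul1r.
- by left; rewrite mulr0.
Qed.

Lemma reflected_chart_in x : standard_surface g (reflected_chart x).
Proof.
have [FS _ _] := F_in x.
have z0 : p1 x = 0 -> (F x).2 - 1/2 = 0 by move=> /p1_0 ->; rewrite subrr.
have y0 : p2 x = 0 -> (F x).1.2 - 3/2 = 0 by move=> /p2_0 ->; rewrite subrr.
have half (s : R * R * R) z : standard_surface g s -> z = s.2 \/ z = 1 - s.2 ->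
    standard_surface g (s.1, z).
  by move=> sS [->|->]; [case: s sS|exact: (standard_surface_mirror_z sS)].
have half' (s : R * R * R) y : standard_surface g s -> y = s.1.2 \/ y = 3 - s.1.2 ->
    standard_surface g (s.1.1, y, s.2).
  by move=> sS [->|->]; [case: s sS => -[? ?] ?|exact: (standard_surface_mirror_y sS)].
apply: (half ((F x).1.1, 3/2 + Num.sg (p2 x) * ((F x).1.2 - 3/2), (F x).2)).
  by apply: half' => //; case: (sg_cases y0) => ->; [left|right]; lra.
by case: (sg_cases z0) => ->; [left|right] => /=; lra.
Qed.

Lemma reflected_chart_continuous : continuous reflected_chart.
Proof.
have cy : continuous (fun x => (F x).1.2 - 3/2).
  by apply: ctsD; [exact/cts_snd/cts_fst|exact: ctsC].
have cz : continuous (fun x => (F x).2 - 1/2).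
  by apply: ctsD; [exact/cts_snd|exact: ctsC].
apply: cts_pair; [apply: cts_pair|].
- by apply/cts_fst/cts_fst.
- apply: ctsD; [exact: ctsC|apply: cts_sg => // x /p2_0 ->; by rewrite subrr].
- apply: ctsD; [exact: ctsC|apply: cts_sg => // x /p1_0 ->; by rewrite subrr].
Qed.

Lemma reflected_chart_surj s : standard_surface g s -> exists x, reflected_chart x = s.
Proof.
move=> sS.
have [x xE] : exists x, F x = (s.1.1, 3/2 + `|s.1.2 - 3/2|, 1/2 + `|s.2 - 1/2|).
  apply: F_surj => /=; [|by rewrite lerDl|by rewrite lerDl].
  have sS' : standard_surface g (s.1, 1/2 + `|s.2 - 1/2|).
    case: (ger0P (s.2 - 1/2)) => h.
      by rewrite addrC subrK; case: (s) sS.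
    rewrite (_ : 1/2 + _ = 1 - s.2); last by lra.
    exact: (standard_surface_mirror_z sS).
  case: (ger0P (s.1.2 - 3/2)) => h.
    by rewrite (addrC (3/2)) subrK -surjective_pairing.
  rewrite (_ : 3/2 + _ = 3 - s.1.2); last by lra.
  exact: (standard_surface_mirror_y sS').
(* reflect x so that its momenta have the signs which s requires *)
have [x1 [x1F x1p]] : exists x1, F x1 = F x /\
    Num.sg (p1 x1) * `|s.2 - 1/2| = s.2 - 1/2.
  case: (ltgtP (p1 x) 0) => px; case: (ger0P (s.2 - 1/2)) => sz.
  - exists (R1 x); have [-> -> _] := R1E x; split=> //.
    by rewrite gtr0_sg ?oppr_gt0 // mul1r.
  - by exists x; split=> //; rewrite ltr0_sg // mulN1r opprK.
  - by exists x; split=> //; rewrite gtr0_sg // mul1r.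
  - exists (R1 x); have [-> -> _] := R1E x; split=> //.
    by rewrite ltr0_sg ?oppr_lt0 // mulN1r opprK.
  - exists x; split=> //; move: (p1_0 px); rewrite xE /= ger0_norm // => e.
    by rewrite (_ : s.2 - 1/2 = 0) ?mulr0 //; lra.
  - by move: (p1_0 px); rewrite xE /= ltr0_norm //; lra.
have {}xE : F x1 = (s.1.1, 3/2 + `|s.1.2 - 3/2|, 1/2 + `|s.2 - 1/2|) by rewrite x1F.
have [x2 [x2F x2p x2p1]] : exists x2, [/\ F x2 = F x1,
    Num.sg (p2 x2) * `|s.1.2 - 3/2| = s.1.2 - 3/2 & p1 x2 = p1 x1].
  case: (ltgtP (p2 x1) 0) => px; case: (ger0P (s.1.2 - 3/2)) => sz.
  - exists (R2 x1); have [-> -> ->] := R2E x1; split=> //.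
    by rewrite gtr0_sg ?oppr_gt0 // mul1r.
  - by exists x1; split=> //; rewrite ltr0_sg // mulN1r opprK.
  - by exists x1; split=> //; rewrite gtr0_sg // mul1r.
  - exists (R2 x1); have [-> -> ->] := R2E x1; split=> //.
    by rewrite ltr0_sg ?oppr_lt0 // mulN1r opprK.
  - exists x1; split=> //; move: (p2_0 px); rewrite xE /= ger0_norm // => e.
    by rewrite (_ : s.1.2 - 3/2 = 0) ?mulr0 //; lra.
  - by move: (p2_0 px); rewrite xE /= ltr0_norm //; lra.
exists x2; rewrite /reflected_chart x2F xE /= x2p1.
have cancel (a b : R) : a + b - a = b by ring.
rewrite !cancel x1p x2p.
have cancel' (a b : R) : a + (b - a) = b by ring.
by rewrite !cancel' -!surjective_pairing.
Qed.

Lemma reflected_chart_glued x y :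
  reflected_chart x = reflected_chart y <-> clos_refl_sym_trans X r x y.
Proof.
split; last first.
  elim=> [{}x {}y|//|{}x {}y _ ->//|{}x {}y z _ -> _ -> //].
  move=> /rE [] [e ->]; rewrite /reflected_chart.
    by have [-> -> ->] := R1E x; rewrite e subrr !mulr0.
  by have [-> -> ->] := R2E x; rewrite e subrr !mulr0.
case=> xE yE zE.
have [_ yx zx] := F_in x; have [_ yy zy] := F_in y.
have {}zE : Num.sg (p1 x) * ((F x).2 - 1/2) = Num.sg (p1 y) * ((F y).2 - 1/2) by lra.
have {}yE : Num.sg (p2 x) * ((F x).1.2 - 3/2) = Num.sg (p2 y) * ((F y).1.2 - 3/2) by lra.
have z0 u : p1 u = 0 -> (F u).2 - 1/2 = 0 by move=> /p1_0 ->; rewrite subrr.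
have y0 u : p2 u = 0 -> (F u).1.2 - 3/2 = 0 by move=> /p2_0 ->; rewrite subrr.
have FE : F x = F y.
  rewrite [F x]surjective_pairing [(F x).1]surjective_pairing.
  rewrite [F y]surjective_pairing [(F y).1]surjective_pairing xE; congr (_, _, _).
    by case: (sg_cases (y0 x)) yE => ->; case: (sg_cases (y0 y)) => ->; lra.
  by case: (sg_cases (z0 x)) zE => ->; case: (sg_cases (z0 y)) => ->; lra.
(* reflect y until its momenta are those of x; each reflection used is either
   trivial or an identification *)
have [y1 [y1g y1F y1p1 y1p2]] : exists y1, [/\ clos_refl_sym_trans X r y y1,
    F y1 = F y, p1 y1 = p1 x & p2 y1 = p2 y].
  have [[e|e] _ _] := F_inj FE; first by exists y; split=> //; exact: rst_refl.
  have [eF e1 e2] := R1E y.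
  have [zh|zh] := eqVneq ((F y).2 - 1/2) 0.
    by exists (R1 y); split=> //; [apply: r1; lra|rewrite e1 e].
  exists y; split=> //; first exact: rst_refl.
  move: zE; rewrite e sgrN FE => /(mulIf zh) h.
  have : Num.sg (p1 y) = 0 by lra.
  by move/eqP; rewrite sgr_eq0 => /eqP ->; rewrite oppr0.
have [y2 [y2g y2F y2p1 y2p2]] : exists y2, [/\ clos_refl_sym_trans X r y1 y2,
    F y2 = F y, p1 y2 = p1 x & p2 y2 = p2 x].
  have [_ [e|e] _] := F_inj FE; first by exists y1; split=> //; [exact: rst_refl|rewrite y1p2].
  have [eF e1 e2] := R2E y1.
  have [zh|zh] := eqVneq ((F y).1.2 - 3/2) 0.
    by exists (R2 y1); split=> //; [apply: r2; rewrite y1F; lra|rewrite eF|rewrite e2|rewrite e1 y1p2 e].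
  exists y1; split=> //; first exact: rst_refl.
  rewrite y1p2; move: yE; rewrite e sgrN FE => /(mulIf zh) h.
  have : Num.sg (p2 y) = 0 by lra.
  by move/eqP; rewrite sgr_eq0 => /eqP ->; rewrite oppr0.
have <- : y2 = x by have [_ _] := F_inj (etrans y2F (esym FE)); apply.
by apply: rst_sym; apply: rst_trans y1g y2g.
Qed.

(** The reflected chart puts each point in the copy of the quarter given by the
signs of p1 and p2.  Two points have the same image when they lie over the
same point of the quarter and differ by reflections that fix this point, which
is when r identifies them. *)
Lemma doubled_surface : genus_surface R g (identification_space r).
Proof.
pose f x : standard_surface g := exist _ (reflected_chart x) (mem_set (reflected_chart_in x)).
apply: (@compact_identification _ _ _ f) => //.
- exact/hausdorff_set_type/norm_hausdorff.
- by apply: continuous_set_val; exact: reflected_chart_continuous.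
- by move=> x y; rewrite -reflected_chart_glued; split=> [/(congr1 val)|e] //; apply/eq_exist; exact: e.
- move=> y; have [x xE] := reflected_chart_surj (set_valP y).
  by exists x; apply: val_inj.
Qed.
End Doubling.

(** * Potential wells *)

Section Wells.
Variable R : realType.
Implicit Types (V : R -> R) (e a b q : R).

(** What the topology of the level sets needs to know about a potential at an
energy e: the motion oscillates between the turning points a and b. *)
Record well V e a b : Prop := Well {
  well_continuous : continuous V;
  well_lt : a < b;
  well_sub : forall q, V q <= e <-> a <= q <= b;
  well_turn : forall q, V q = e <-> q = a \/ q = b }.

Lemma potential_derivable V q : confining_potential V -> derivable V q 1.
Proof. by move=> hV; have := @potential_smooth _ _ hV 0%N q; rewrite derive1n0. Qed.

Lemma potential_continuous V : confining_potential V -> continuous V.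
Proof.
by move=> hV q; apply/differentiable_continuous/derivable1_diffP; exact: potential_derivable.
Qed.

Lemma potential_pos V q : confining_potential V -> q != 0 -> 0 < V q.
Proof. by move=> hV q0; rewrite -(potential_at0 hV); exact: potential_unique_min. Qed.

Lemma potential_incr V x y : confining_potential V -> 0 <= x -> x < y -> V x < V y.
Proof.
move=> hV x0 xy; have cV := potential_continuous hV.
have H := @gtr0_derive1_lt_cc R V 0 y _ _ _; apply: H => //.
- by move=> z _; exact: potential_derivable.
- move=> z; rewrite in_itv /= => /andP[z0 _].
  by have := potential_single_well hV (lt0r_neq0 z0); rewrite pmulr_rgt0.
- exact: continuous_subspaceT.
- by rewrite in_itv /= x0 ltW.
- by rewrite in_itv /= lexx ltW // (le_lt_trans x0).
Qed.

Lemma potential_decr V x y : confining_potential V -> y <= 0 -> x < y -> V y < V x.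
Proof.
move=> hV y0 xy; have cV := potential_continuous hV.
have H := @ltr0_derive1_lt_cc R V x 0 _ _ _; apply: H => //.
- by move=> z _; exact: potential_derivable.
- move=> z; rewrite in_itv /= => /andP[_ z0].
  by have := potential_single_well hV (ltr0_neq0 z0); rewrite nmulr_rgt0.
- exact: continuous_subspaceT.
- by rewrite in_itv /= y0 ltW.
- by rewrite in_itv /= lexx ltW // (lt_le_trans xy).
Qed.

(** V decreases to 0 and then increases, so the level e is reached once on each
side of the origin. *)
Lemma potential_well V e : confining_potential V -> 0 < e ->
  exists a b, [/\ a < 0, 0 < b & well V e a b].
Proof.
move=> hV e0; have cV := potential_continuous hV.
have V0 := potential_at0 hV.
have cVw (A : set R) : {within A, continuous V} by exact: continuous_subspaceT.
have [b b0 bE] : exists2 b, 0 < b & V b = e.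
  have /cvgryPgt /(_ e) h := potential_cvg_pinfty hV.
  have [q [q1 q2]] := filter_ex (filterI h (nbhs_pinfty_gt (num_real 0))).
  have [|b] := @IVT R V 0 q e (ltW q2) (cVw _).
    by rewrite V0 ge_min le_max (ltW e0) (ltW q1) orbT.
  rewrite in_itv /= => /andP[b0 _] bE; exists b => //.
  by rewrite lt_neqAle b0 andbT; apply: contraTneq e0 => e'; rewrite -bE -e' V0 ltxx.
have [a a0 aE] : exists2 a, a < 0 & V a = e.
  have /cvgryPgt /(_ e) h := potential_cvg_ninfty hV.
  have [q [q1 q2]] := filter_ex (filterI h (nbhs_ninfty_lt (num_real 0))).
  have [|a] := @IVT R V q 0 e (ltW q2) (cVw _).
    by rewrite V0 ge_min le_max (ltW e0) (ltW q1) orbT.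
  rewrite in_itv /= => /andP[_ a0] aE; exists a => //.
  by rewrite lt_neqAle a0 andbT; apply: contraTneq e0 => e'; rewrite -aE e' V0 ltxx.
have out q : q < a \/ b < q -> e < V q.
  case=> h; first by rewrite -aE; apply: potential_decr => //; exact: ltW.
  by rewrite -bE; apply: potential_incr => //; exact: ltW.
have inn q : a < q < b -> V q < e.
  move=> /andP[aq qb]; case: (leP 0 q) => q0; first by rewrite -bE; exact: potential_incr.
  by rewrite -aE; apply: potential_decr => //; exact: ltW.
exists a, b; split=> //; split=> //; first exact: lt_trans b0.
- move=> q; split=> [Vq|/andP[]].
    apply/andP; split; rewrite leNgt; apply/negP => h.
      by have := out q (or_introl h); rewrite ltNge Vq.
    by have := out q (or_intror h); rewrite ltNge Vq.
  rewrite le_eqVlt => /orP[/eqP <-|aq]; first by rewrite aE.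
  rewrite le_eqVlt => /orP[/eqP ->|qb]; first by rewrite bE.
  by rewrite ltW // inn // aq.
- move=> q; split=> [Vq|[]->//].
  have [h|h|->] := ltgtP q a; last by left.
    by have := out q (or_introl h); rewrite Vq ltxx.
  have [h'|h'|->] := ltgtP q b; last by right.
    by have := inn q; rewrite h h' Vq ltxx => /(_ isT).
  by have := out q (or_intror h'); rewrite Vq ltxx.
Qed.

Lemma well_lt_energy V e a b q : well V e a b -> a < q < b -> V q < e.
Proof.
move=> W /andP[aq qb]; rewrite lt_neqAle; apply/andP; split.
  by apply/eqP => /(well_turn W) [] E; [move: aq|move: qb]; rewrite E ltxx.
by apply/(well_sub W); rewrite !ltW.
Qed.
End Wells.

(** * Level sets over their configuration space *)

Section EnergyCurve.
Variables (R : realType) (V : R -> R) (e a b : R).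
Hypothesis W : well V e a b.

Lemma energy_reflect u : energy V (reflect_p u) = energy V u.
Proof. by rewrite /energy /reflect_p /= sqrrN. Qed.

Lemma energy_position u : energy V u = e -> a <= u.1 <= b.
Proof.
rewrite /energy => E; apply/(well_sub W).
by have := sqr_ge0 u.2; lra.
Qed.

Lemma energy_turn u : energy V u = e -> (u.2 = 0 <-> u.1 = a \/ u.1 = b).
Proof.
rewrite /energy => E; rewrite -(well_turn W); split=> [p0|q0].
  by move: E; rewrite p0 expr0n /=; lra.
apply/eqP; rewrite -sqrf_eq0; apply/eqP; lra.
Qed.

Lemma energy_momentum u u' : energy V u = e -> energy V u' = e -> u.1 = u'.1 ->
  u.2 = u'.2 \/ u.2 = - u'.2.
Proof.
rewrite /energy => E E' q; have /eqP : u.2 ^+ 2 = u'.2 ^+ 2 by rewrite q in E; lra.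
by rewrite eqf_sqr => /orP[] /eqP; [left|right].
Qed.

Definition lift_up (q : R) : R * R := (q, Num.sqrt (2 * (e - V q))).

Lemma lift_up_energy q : a <= q <= b -> energy V (lift_up q) = e.
Proof.
by move=> /(well_sub W) Vq; rewrite /energy /= sqr_sqrtr; lra.
Qed.

Lemma lift_up_continuous : continuous lift_up.
Proof.
apply: cts_pair; first by move=> ?; exact: cvg_id.
move=> q; apply: continuous_comp; last exact: sqrt_continuous.
apply: ctsM; first exact: ctsC.
by apply: ctsD; [exact: ctsC|apply: ctsN; exact: (well_continuous W)].
Qed.

(** The curve is the union of the graph of the positive momentum over [a, b]
and of its reflection. *)
Lemma energy_curve_compact : compact [set u | energy V u = e].
Proof.
have cr : continuous (@reflect_p R).
  by apply: cts_pair; [apply: cts_fst|apply/ctsN/cts_snd] => ?; exact: cvg_id.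
have -> : [set u | energy V u = e] =
    lift_up @` `[a, b] `|` (@reflect_p R) @` (lift_up @` `[a, b]).
  rewrite eqEsubset; split=> [u /= E|_ [[q qB <-]|[_ [q qB <-] <-]]] /=.
  - have qB := energy_position E.
    have qI : `[a, b]%classic u.1 by rewrite /= in_itv.
    have [h|h] := @energy_momentum u (lift_up u.1) E (lift_up_energy qB) erefl.
      by left; exists u.1 => //; rewrite /lift_up [RHS]surjective_pairing h.
    right; exists (lift_up u.1); first by exists u.1.
    by rewrite /reflect_p /= [RHS]surjective_pairing h.
  - by apply: lift_up_energy; move: qB; rewrite /= in_itv.
  - by rewrite energy_reflect; apply: lift_up_energy; move: qB; rewrite /= in_itv.
have cl : compact (lift_up @` `[a, b]).
  apply: continuous_compact; last exact: segment_compact.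
  exact/continuous_subspaceT/lift_up_continuous.
apply: compactU => //; apply: continuous_compact => //.
exact: continuous_subspaceT.
Qed.
End EnergyCurve.

Section LevelSets.
Variables (R : realType) (V1 V2 : R -> R) (w1 w2 e1 e2 a1 b1 a2 b2 : R).
Hypotheses (W1 : well V1 e1 a1 b1) (W2 : well V2 e2 a2 b2).
Local Notation X := (level_points V1 V2 w1 w2 e1 e2).
Implicit Types x y : X.

Definition position x : R * R := ((set_val x).1.1, (set_val x).2.1).

Definition config (q : R * R) : Prop :=
  [/\ a1 <= q.1 <= b1, a2 <= q.2 <= b2 & ~ (q.1 < w1 /\ q.2 < w2)].

Lemma levelP x : [/\ ~ step_region w1 w2 (position x),
  energy V1 (set_val x).1 = e1 & energy V2 (set_val x).2 = e2].
Proof. by case: (set_valP x). Qed.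

Lemma position_config x : config (position x).
Proof.
have [nS E1 E2] := levelP x; split=> //.
  exact: (energy_position W1 E1).
exact: (energy_position W2 E2).
Qed.

Fact reflect1_subproof x : (reflect_p (set_val x).1, (set_val x).2) \in X.
Proof. by apply/mem_set; have [? ? ?] := levelP x; split=> //=; rewrite energy_reflect. Qed.
Definition reflect1 x : X := exist (fun u => u \in X) _ (reflect1_subproof x).

Fact reflect2_subproof x : ((set_val x).1, reflect_p (set_val x).2) \in X.
Proof. by apply/mem_set; have [? ? ?] := levelP x; split=> //=; rewrite energy_reflect. Qed.
Definition reflect2 x : X := exist (fun u => u \in X) _ (reflect2_subproof x).

Lemma level_points_compact : compact X.
Proof.
have -> : X = ([set u | energy V1 u = e1] `*` [set u | energy V2 u = e2]) `&`
    ~` [set x : phase_space R | x.1.1 < w1 /\ x.2.1 < w2].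
  by rewrite eqEsubset; split=> [x [? ? ?]|x [[? ?] ?]].
apply: compact_closedI.
  by apply: compact_setX; [exact: energy_curve_compact W1|exact: energy_curve_compact W2].
apply: open_closedC.
have -> : [set x : phase_space R | x.1.1 < w1 /\ x.2.1 < w2] =
   (fun x : phase_space R => x.1.1) @^-1` [set q | q < w1] `&`
   (fun x : phase_space R => x.2.1) @^-1` [set q | q < w2] by [].
apply: openI; (apply: open_comp; last exact: open_lt) => x _.
  by apply: (@cts_fst _ _ _ (fun x : phase_space R => x.1)); apply: cts_fst => ?; exact: cvg_id.
by apply: (@cts_fst _ _ _ (fun x : phase_space R => x.2)); apply: cts_snd => ?; exact: cvg_id.
Qed.

Lemma level_momenta_continuous :
  continuous (fun x => (set_val x).1.2) /\ continuous (fun x => (set_val x).2.2).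
Proof.
have c := @set_val_continuous _ X.
by split; [apply/cts_snd/cts_fst|apply/cts_snd/cts_snd].
Qed.

Lemma position_continuous : continuous position.
Proof.
have c := @set_val_continuous _ X.
by apply: cts_pair; [apply/cts_fst/cts_fst|apply/cts_fst/cts_snd].
Qed.

(** The two equivalences say that F maps the edges where the reflection of p1
(of p2) is trivial or identified to the arcs of the quarter in the plane
z = 1/2 (y = 3/2). *)
Lemma level_genus (g : nat) (F : R * R -> R * R * R) :
  continuous (fun x => F (position x)) ->
  (forall q, config q ->
    [/\ standard_surface g (F q), 3/2 <= (F q).1.2 & 1/2 <= (F q).2]) ->
  (forall q q', config q -> config q' -> F q = F q' -> q = q') ->
  (forall s, standard_surface g s -> 3/2 <= s.1.2 -> 1/2 <= s.2 ->
    exists2 q, config q & F q = s) ->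
  (forall q, config q -> (F q).2 = 1/2 <->
    (q.1 = a1 \/ q.1 = b1) \/ (q.1 = w1 /\ q.2 <= w2)) ->
  (forall q, config q -> (F q).1.2 = 3/2 <->
    (q.2 = a2 \/ q.2 = b2) \/ (q.1 <= w1 /\ q.2 = w2)) ->
  genus_surface R g (level_set V1 V2 w1 w2 e1 e2).
Proof.
move=> cF Fin Finj Fsurj F1 F2.
have [cp1 cp2] := level_momenta_continuous.
have turn1 x : (set_val x).1.2 = 0 <-> (position x).1 = a1 \/ (position x).1 = b1.
  by have [_ E _] := levelP x; exact: (energy_turn W1 E).
have turn2 x : (set_val x).2.2 = 0 <-> (position x).2 = a2 \/ (position x).2 = b2.
  by have [_ _ E] := levelP x; exact: (energy_turn W2 E).
apply: (@doubled_surface R g _ _ reflect1 reflect2 (fun x => (set_val x).1.2)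
  (fun x => (set_val x).2.2) (F \o position)) => //.
- exact/compact_set_type/level_points_compact.
- by move=> x; exact/Fin/position_config.
- move=> s sS sy sz; have [q qc qF] := Fsurj s sS sy sz.
  have [q1B q2B nS] := qc.
  have xX : (lift_up V1 e1 q.1, lift_up V2 e2 q.2) \in X.
    apply/mem_set; split=> //=.
      exact: (lift_up_energy W1).
    exact: (lift_up_energy W2).
  by exists (exist (fun u => u \in X) _ xX); rewrite /= -qF; congr F; rewrite [RHS]surjective_pairing.
- by move=> x /turn1 h; apply/(F1 _ (position_config x)); left.
- by move=> x /turn2 h; apply/(F2 _ (position_config x)); left.
- move=> x y /= /(Finj _ _ (position_config x) (position_config y)) [q1 q2].
  have [_ E1 E2] := levelP x; have [_ E1' E2'] := levelP y.
  split; [exact: (energy_momentum E1 E1')|exact: (energy_momentum E2 E2')|].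
  move=> p1 p2; apply: set_val_inj.
  by apply: injective_projections; apply: injective_projections.
- move=> x y [[[h1 h2] E]|[[h1 h2] E]]; [left|right]; (split; last exact: set_val_inj).
    by apply/(F1 _ (position_config x)); right.
  by apply/(F2 _ (position_config x)); right.
- move=> x /(F1 _ (position_config x)) [/turn1 p0|b].
    suff -> : reflect1 x = x by exact: rst_refl.
    apply: set_val_inj => /=; apply: injective_projections => //=.
    by apply: injective_projections => //=; rewrite p0 oppr0.
  by apply: rst_step; left.
- move=> x /(F2 _ (position_config x)) [/turn2 p0|b].
    suff -> : reflect2 x = x by exact: rst_refl.
    apply: set_val_inj => /=; apply: injective_projections => //=.
    by apply: injective_projections => //=; rewrite p0 oppr0.
  by apply: rst_step; right.
Qed.
End LevelSets.

(** * Continuity of the charts *)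

Section ChartContinuity.
Context {R : realType} {T : topologicalType}.
Implicit Types f g : T -> R.

Lemma cts_ramp f g : continuous f -> continuous g -> continuous (fun t => ramp (f t) (g t)).
Proof. by move=> cf cg; apply: cts_max; [exact: ctsC|exact: cts_min]. Qed.

Lemma cts_clip (c : R) g : continuous g -> continuous (fun t => clip c (g t)).
Proof.
by move=> cg; apply: cts_max; [exact: ctsC|apply: cts_min => //; exact: ctsC].
Qed.

Lemma cts_chart (c : R) (inner : R -> R -> R * R * R) f g :
  (forall d tau : T -> R, continuous d -> continuous tau ->
     continuous (fun t => inner (d t) (tau t))) ->
  continuous f -> continuous g -> continuous (fun t => chart c inner (f t) (g t)).
Proof.
move=> ci cf cg.
have cd : continuous (fun t => Num.max 0 (- f t)).
  by apply: cts_max; [exact: ctsC|exact: ctsN].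
have cl : continuous (fun t => ramp 1 (f t)) by apply: cts_ramp => //; exact: ctsC.
have cp := ci _ _ cd cg.
apply: cts_pair; [apply: cts_pair|].
- apply: ctsD; first exact: ctsC.
  apply: ctsM; last exact/cts_fst/cts_fst.
  by apply: ctsD; [exact: ctsC|apply: ctsM => //; exact: ctsC].
- apply: ctsD; first exact: ctsC.
  apply: ctsM; apply: ctsD; first exact: ctsC.
  + by apply: ctsM => //; exact: ctsC.
  + exact: ctsC.
  + exact/ctsN/cts_snd/cts_fst.
- apply: ctsD.
    by apply: ctsD; [exact: ctsC|exact/ctsN/cts_snd].
  apply/ctsN/cts_max; first exact: ctsC.
  by apply: ctsD => //; exact: ctsC.
Qed.

Lemma cts_sheet1 f g : continuous f -> continuous g ->
  continuous (fun t => sheet1 (f t) (g t)).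
Proof.
move=> cf cg; apply: cts_pair => //; apply: cts_pair; first exact: cts_clip.
by apply: cts_max; [exact: ctsC|apply: ctsD; [exact: cts_norm|exact: ctsC]].
Qed.

Lemma cts_sheet2 f g : continuous f -> continuous g ->
  continuous (fun t => sheet2 (f t) (g t)).
Proof.
move=> cf cg.
have c2 : continuous (fun t => 2 * f t) by apply: ctsM => //; exact: ctsC.
have cs : continuous (fun t => (2 + 2 * f t) * g t).
  by apply: ctsM => //; apply: ctsD => //; exact: ctsC.
have cn := cts_norm cs.
apply: cts_pair; [apply: cts_pair|].
- apply: ctsB.
    apply: ctsD; first exact: cts_clip.
    by apply: cts_ramp; [exact: ctsC|apply: ctsB => //; exact: cts_shift].
  apply: cts_ramp; first exact: ctsC.
  by apply: ctsB => //; apply: cts_shift; exact: ctsN.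
- apply: ctsD.
    apply: ctsB => //; apply: cts_ramp => //; apply: ctsB => //; exact: cts_shift.
  by apply: cts_max; [exact: ctsC|apply: ctsB => //; exact: cts_shift].
- by apply: cts_ramp => //; exact: cts_shift.
Qed.
End ChartContinuity.

Section Charts.
Variable R : realType.

Definition chart1 (q : R * R) := chart (1/2) (@sheet1 R) q.1 q.2.
Definition chart2 (q : R * R) := chart (3/2) (@sheet2 R) q.1 q.2.
(** The common domain of the two charts of the quarter. *)
Definition panel (q : R * R) : Prop := - (1/2) <= q.1 <= 3/2 /\ -1 <= q.2 <= 1.

Lemma quarter_pos (c : R) K s : quarter c K s -> 3/2 <= s.1.2 /\ 1/2 <= s.2.
Proof. by case=> /andP[? _] /andP[? _] _ _. Qed.

Lemma half_gt0 : 0 < 1/2 :> R. Proof. by lra. Qed.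
Lemma three_half_gt0 : 0 < 3/2 :> R. Proof. by lra. Qed.

Definition surface_chart (g : nat) (C : R * R -> R * R * R) : Prop :=
  [/\ forall q, panel q -> [/\ standard_surface g (C q), 3/2 <= (C q).1.2 & 1/2 <= (C q).2],
      forall q q', panel q -> panel q' -> C q = C q' -> q = q' &
      forall s, standard_surface g s -> 3/2 <= s.1.2 -> 1/2 <= s.2 ->
        exists2 q, panel q & C q = s].

Lemma chart1_surface : surface_chart 1 chart1.
Proof.
have H := sheet1_inner R; have c0 := half_gt0; split.
- move=> q [rB tB]; have Q := chart_in c0 H rB tB; have [y0 z0] := quarter_pos Q.
  by split=> //; exact/surface1_quarter.
- move=> [r t] [r' t'] [rB tB] [rB' tB'] E.
  by have [/= -> ->] := chart_inj c0 H rB tB rB' tB' E.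
- move=> s sS y0 z0; have [r [t [rB tB E]]] := chart_surj c0 H (proj1 (surface1_quarter y0 z0) sS).
  by exists (r, t).
Qed.

Lemma chart2_surface : surface_chart 2 chart2.
Proof.
have H := sheet2_inner R; have c0 := three_half_gt0; split.
- move=> q [rB tB]; have Q := chart_in c0 H rB tB; have [y0 z0] := quarter_pos Q.
  by split=> //; exact/surface2_quarter.
- move=> [r t] [r' t'] [rB tB] [rB' tB'] E.
  by have [/= -> ->] := chart_inj c0 H rB tB rB' tB' E.
- move=> s sS y0 z0; have [r [t [rB tB E]]] := chart_surj c0 H (proj1 (surface2_quarter y0 z0) sS).
  by exists (r, t).
Qed.
End Charts.

(** * Straightening rectangles and steps *)

Section Straighten.
Variable R : realFieldType.
Implicit Types (q w a b x y X Y : R).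

Definition affine a b x y q : R := x + (y - x) * ((q - a) / (b - a)).

Lemma affine_mono a b x y : a < b -> x < y -> {mono affine a b x y : q q' / q <= q'}.
Proof.
move=> ab xy q q'; rewrite /affine lerD2l ler_pM2l ?subr_gt0 //.
by rewrite ler_pM2r ?invr_gt0 ?subr_gt0 // lerD2r.
Qed.

Lemma affine_ends a b x y : a < b -> affine a b x y a = x /\ affine a b x y b = y.
Proof.
move=> ab; rewrite /affine subrr mul0r mulr0 addr0 divff ?subr_eq0 ?gt_eqF //.
by split=> //; ring.
Qed.

Lemma affineK a b x y q : a < b -> x < y -> affine a b x y (affine x y a b q) = q.
Proof. by move=> ab xy; rewrite /affine; field; rewrite !subr_eq0 !gt_eqF. Qed.

(** Maps [a, w] affinely to [-1, 0] and [w, b] to [0, 1]. *)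
Definition hinge a w b q : R :=
  Num.min (q - w) 0 / (w - a) + Num.max (q - w) 0 / (b - w).

Variant hinge_spec a w b q : R -> Prop :=
| HingeLeft of q <= w : hinge_spec a w b q ((q - w) / (w - a))
| HingeRight of w <= q : hinge_spec a w b q ((q - w) / (b - w)).

Lemma hingeP a w b q : hinge_spec a w b q (hinge a w b q).
Proof.
rewrite /hinge; case: (leP (q - w) 0) => h; rewrite mul0r ?addr0 ?add0r; constructor; lra.
Qed.

Lemma hinge_mono a w b : a < w -> w < b -> {mono hinge a w b : q q' / q <= q'}.
Proof.
move=> aw wb; apply: le_mono => q q' qq'.
have d1 : 0 < w - a by lra.
have d2 : 0 < b - w by lra.
case: hingeP => h; case: hingeP => h'.
- by rewrite ltr_pM2r ?invr_gt0 // ltrD2r.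
- have [qw|qw] := eqVneq q w.
    by rewrite qw subrr mul0r divr_gt0 //; lra.
  have {}h : q < w by rewrite lt_neqAle qw.
  apply: (@lt_le_trans _ _ 0); last by rewrite divr_ge0 //; lra.
  by rewrite pmulr_llt0 ?invr_gt0 //; lra.
- by exfalso; lra.
- by rewrite ltr_pM2r ?invr_gt0 // ltrD2r.
Qed.

Lemma hinge_values a w b : a < w -> w < b ->
  [/\ hinge a w b a = -1, hinge a w b w = 0 & hinge a w b b = 1].
Proof.
move=> aw wb; split.
- case: hingeP => h; last by exfalso; lra.
  by rewrite -opprB mulNr divff // subr_eq0 gt_eqF.
- by case: hingeP => _; rewrite subrr mul0r.
- case: hingeP => h; first by exfalso; lra.
  by rewrite divff // subr_eq0 gt_eqF.
Qed.

Lemma hinge_surj a w b x : a < w -> w < b -> exists q, hinge a w b q = x.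
Proof.
move=> aw wb; have d1 : 0 < w - a by lra.
have d2 : 0 < b - w by lra.
case: (leP 0 x) => x0; [exists (w + x * (b - w))|exists (w + x * (w - a))].
  have h0 : 0 <= x * (b - w) by rewrite mulr_ge0 // ltW.
  have k : w + x * (b - w) - w = x * (b - w) by ring.
  case: hingeP => h; rewrite k; last by rewrite mulfK // gt_eqF.
  have : x * (b - w) = 0 by lra.
  by move=> /eqP; rewrite mulf_eq0 (gt_eqF d2) orbF => /eqP ->; rewrite !mul0r.
have h0 : x * (w - a) < 0 by rewrite pmulr_llt0.
have k : w + x * (w - a) - w = x * (w - a) by ring.
by case: hingeP => h; rewrite k; [rewrite mulfK // gt_eqF|exfalso; lra].
Qed.

Definition stair x y : Prop := [/\ -1 <= x <= 1, -1 <= y <= 1 & ~ (x < 0 /\ y < 0)].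

(** The L-shape is foliated by the stairs with corners (X, X) and
(2X - 1, X): up along x = X, left along y = X, up along x = 2X - 1.  They go
from the stair of edges around the missing corner, X = 0, to the right edge,
X = 1; tread is the number X of the stair and run a parameter along it,
ranging from -1 to 2 - X.  Thus the two edges around the missing corner and
the left edge, of length one each, become one side of a quadrilateral, divided
in thirds. *)
Definition tread x y : R := Num.min ((x + 1) / 2) (Num.max x y).
Definition run x y : R := tread x y + y - x.

Variant stair_spec x y : R -> R -> Prop :=
| StairLow of y <= x & 0 <= x : stair_spec x y x y
| StairMid of x <= y & 2 * y - 1 <= x & 0 <= y : stair_spec x y y (2 * y - x)
| StairHigh of x <= 2 * y - 1 & 0 <= y : stair_spec x y ((x + 1) / 2) (y + (1 - x) / 2).

Lemma stairP x y : stair x y -> stair_spec x y (tread x y) (run x y).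
Proof.
move=> [xB yB nS]; rewrite /run /tread; have [yx|xy] := leP y x.
  have x0 : 0 <= x by rewrite leNgt; apply/negP => h; apply: nS; split; lra.
  rewrite min_r; last by lra.
  by rewrite (_ : x + y - x = y); [constructor|ring].
have y0 : 0 <= y by rewrite leNgt; apply/negP => h; apply: nS; split; lra.
have [h|h] := leP ((x + 1) / 2) y.
  rewrite (_ : (x + 1) / 2 + y - x = y + (1 - x) / 2); last by field.
  by constructor; lra.
rewrite (_ : y + y - x = 2 * y - x); last by ring.
by constructor; lra.
Qed.

Lemma stair_bound x y : stair x y ->
  0 <= tread x y <= 1 /\ -1 <= run x y <= 2 - tread x y.
Proof. by move=> S; case: (stairP S) => *; case: S => ? ? ?; lra. Qed.

Lemma stair_inj x y x' y' : stair x y -> stair x' y' ->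
  tread x y = tread x' y' -> run x y = run x' y' -> x = x' /\ y = y'.
Proof.
move=> S S'; case: (stairP S) => [? ?|? ? ?|? ?]; case: (stairP S') => [? ?|? ? ?|? ?] ? ?;
  by case: S => ? ? _; case: S' => ? ? _; split; lra.
Qed.

Lemma stair_surj X Y : 0 <= X <= 1 -> -1 <= Y <= 2 - X ->
  exists x y, [/\ stair x y, tread x y = X & run x y = Y].
Proof.
move=> XB YB.
have [YX|XY] := leP Y X.
  have S : stair X Y by split; [lra|lra|case; lra].
  by exists X, Y; split=> //; case: (stairP S) => *; lra.
have [Y1|Y1] := leP Y 1.
  have S : stair (2 * X - Y) X by split; [lra|lra|case; lra].
  by exists (2 * X - Y), X; split=> //; case: (stairP S) => *; lra.
have S : stair (2 * X - 1) (Y - 1 + X) by split; [lra|lra|case; lra].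
by exists (2 * X - 1), (Y - 1 + X); split=> //; case: (stairP S) => *; lra.
Qed.

Lemma stair_edges x y : stair x y ->
  (tread x y = 1 \/ (tread x y = 0 /\ (run x y <= 0 \/ 1 <= run x y)) <->
     (x = -1 \/ x = 1) \/ (x = 0 /\ y <= 0)) /\
  ((run x y = -1 \/ run x y = 2 - tread x y) \/ (tread x y = 0 /\ 0 <= run x y <= 1) <->
     (y = -1 \/ y = 1) \/ (x <= 0 /\ y = 0)).
Proof.
move=> S; have [xB yB _] := S.
case: (stairP S) => [? ?|? ? ?|? ?]; split; split.
all: try (by case=> [[?|?]|[? ?]]; first
  [ by exfalso; lra | by left; left; lra | by left; right; lra | by right; split; lra]).
all: try (by case=> [?|[? [?|?]]]; first
  [ by exfalso; lra | by left; left; lra | by left; right; lra | by right; split; lra]).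
all: case=> [[?|?]|[? ?]]; first
  [ by exfalso; lra | by left; lra | by right; split; [lra|left; lra]
  | by right; split; [lra|right; lra] ].
Qed.

(** The stairs are spread over the rows of the panel, and the parameter is
normalized to [-1, 1] on each. *)
Definition stair_row x y : R := 2 * tread x y - 1/2.
Definition stair_column x y : R := (2 * run x y - 1 + tread x y) / (3 - tread x y).

Lemma div_eq (p q d : R) : 0 < d -> p / d = q <-> p = q * d.
Proof. by move=> d0; split=> [<-|->]; rewrite ?divfK ?mulfK ?gt_eqF. Qed.

Lemma stair_columnE x y : stair x y ->
  [/\ (-1 <= stair_column x y <= 1), (stair_column x y = -1 <-> run x y = -1),
      (stair_column x y = 1 <-> run x y = 2 - tread x y) &
      tread x y = 0 -> stair_column x y = (2 * run x y - 1) / 3].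
Proof.
move=> S; have [XB YB] := stair_bound S; rewrite /stair_column.
have d0 : 0 < 3 - tread x y by lra.
split.
- by rewrite ler_pdivlMr // ler_pdivrMr //; lra.
- by rewrite div_eq //; split; lra.
- by rewrite div_eq //; split; lra.
- by move=> ->; rewrite addr0 subr0.
Qed.

Lemma stair_panel_inj x y x' y' : stair x y -> stair x' y' ->
  stair_row x y = stair_row x' y' -> stair_column x y = stair_column x' y' ->
  x = x' /\ y = y'.
Proof.
move=> S S' r c; have e : tread x y = tread x' y' by move: r; rewrite /stair_row; lra.
have [XB _] := stair_bound S'.
apply: stair_inj => //; move: c; rewrite /stair_column e => /(mulIf _) h.
suff : 2 * run x y - 1 + tread x' y' = 2 * run x' y' - 1 + tread x' y' by lra.
by apply: h; rewrite invr_eq0 gt_eqF //; lra.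
Qed.

Lemma stair_panel_surj rho tau : - (1/2) <= rho <= 3/2 -> -1 <= tau <= 1 ->
  exists x y, [/\ stair x y, stair_row x y = rho & stair_column x y = tau].
Proof.
move=> rB tB; pose X := (rho + 1/2) / 2.
have XB : 0 <= X <= 1 by rewrite /X; lra.
have k : - (3 - X) <= tau * (3 - X) <= 3 - X by nra.
have [|x [y [S xX yY]]] := @stair_surj X ((tau * (3 - X) + 1 - X) / 2) XB.
  by lra.
exists x, y; split=> //; first by rewrite /stair_row xX /X; lra.
rewrite /stair_column xX yY.
by apply/div_eq; lra.
Qed.

Lemma stair_row_ends x y :
  (stair_row x y = 3/2 <-> tread x y = 1) /\
  (stair_row x y = - (1/2) <-> tread x y = 0).
Proof. by rewrite /stair_row; move: (tread x y) => t; split; split=> ?; lra. Qed.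

Lemma third_marks (p t : R) : p = (2 * t - 1) / 3 ->
  [/\ (p <= - (1/3)) = (t <= 0), (1/3 <= p) = (1 <= t) &
      (- (1/3) <= p <= 1/3) = (0 <= t <= 1)].
Proof. by move=> ->; split; apply/idP/idP; lra. Qed.

Lemma stair_panel_edges x y : stair x y ->
  let rho := stair_row x y in let tau := stair_column x y in
  (rho = 3/2 \/ (rho = - (1/2) /\ (tau <= - (1/3) \/ 1/3 <= tau)) <->
     (x = -1 \/ x = 1) \/ (x = 0 /\ y <= 0)) /\
  ((tau = -1 \/ tau = 1) \/ (rho = - (1/2) /\ - (1/3) <= tau <= 1/3) <->
     (y = -1 \/ y = 1) \/ (x <= 0 /\ y = 0)).
Proof.
move=> S /=; have [E1 E2] := stair_edges S.
have [_ c1 c2 c3] := stair_columnE S.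
have [r1 r0] := stair_row_ends x y.
split; [apply: iff_trans E1|apply: iff_trans E2].
  split=> -[h|[/r0 h h']]; [by left; apply/r1| |by left; apply/r1|].
    by right; split=> //; have [<- <- _] := third_marks (c3 h).
  by right; split=> //; have [-> -> _] := third_marks (c3 (r0.1 h)).
split=> -[[h|h]|[/r0 h h']].
- by left; left; apply/c1.
- by left; right; apply/c2.
- by right; split=> //; have [_ _ <-] := third_marks (c3 h).
- by left; left; apply/c1.
- by left; right; apply/c2.
- by right; split=> //; have [_ _ ->] := third_marks (c3 (r0.1 h)).
Qed.
End Straighten.

(** * Regular level sets *)

Section Genus.
Variables (R : realType) (V1 V2 : R -> R) (w1 w2 e1 e2 a1 b1 a2 b2 : R).
Hypotheses (W1 : well V1 e1 a1 b1) (W2 : well V2 e2 a2 b2).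
Local Notation X := (level_points V1 V2 w1 w2 e1 e2).
Local Notation config := (config w1 w2 a1 b1 a2 b2).

Lemma affine_facts (a b x y q : R) : a < b -> x < y ->
  [/\ (x <= affine a b x y q <= y) = (a <= q <= b),
      affine a b x y q = x <-> q = a & affine a b x y q = y <-> q = b].
Proof.
move=> ab xy; have m := affine_mono ab xy; have [ea eb] := affine_ends x y ab.
split.
- by have := m a q; have := m q b; rewrite ea eb => -> ->.
- by split=> [h|->//]; apply: (inc_inj m); rewrite h.
- by split=> [h|->//]; apply: (inc_inj m); rewrite h.
Qed.

Lemma cts_affine (T : topologicalType) (a b x y : R) (f : T -> R) :
  continuous f -> continuous (fun t => affine a b x y (f t)).
Proof.
move=> cf; apply: ctsD; first exact: ctsC.
apply: ctsM; first exact: ctsC.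
by apply: ctsM; [exact: cts_shift|exact: ctsC].
Qed.

(** The configuration space is the rectangle a1 <= q1 <= b1, c <= q2 <= b2,
whose lower side c is a turning point or the wall. *)
Lemma level_genus1 c : c < b2 ->
  (forall q, config q <-> a1 <= q.1 <= b1 /\ c <= q.2 <= b2) ->
  (forall q, config q -> ~ (q.1 = w1 /\ q.2 <= w2)) ->
  (forall q, config q ->
     (q.2 = a2 \/ q.2 = b2) \/ (q.1 <= w1 /\ q.2 = w2) <-> q.2 = c \/ q.2 = b2) ->
  genus_surface R 1 (level_set V1 V2 w1 w2 e1 e2).
Proof.
move=> cb confE no1 edge2; have ab1 := well_lt W1.
have [Cin Cinj Csurj] := chart1_surface R.
have lt1 : - (1/2) < 3/2 :> R by lra.
have lt2 : -1 < 1 :> R by lra.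
pose N (q : R * R) := (affine a1 b1 (- (1/2)) (3/2) q.1, affine c b2 (-1) 1 q.2).
have Npanel q : panel (N q) <-> config q.
  rewrite confE /panel /N /=; have [-> _ _] := affine_facts q.1 ab1 lt1.
  by have [-> _ _] := affine_facts q.2 cb lt2.
have cp := @position_continuous R V1 V2 w1 w2 e1 e2.
apply: (@level_genus _ _ _ _ _ _ _ _ _ _ _ W1 W2 1 (@chart1 R \o N)).
- apply: cts_chart; first exact: cts_sheet1.
    by apply/cts_affine/cts_fst.
  by apply/cts_affine/cts_snd.
- by move=> q /Npanel; exact: Cin.
- move=> q q' /Npanel cq /Npanel cq' /(Cinj _ _ cq cq') [h1 h2].
  apply: injective_projections; first exact: (inc_inj (affine_mono ab1 lt1)).
  exact: (inc_inj (affine_mono cb lt2)).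
- move=> s sS sy sz; have [p pp pE] := Csurj s sS sy sz.
  pose q := (affine (- (1/2)) (3/2) a1 b1 p.1, affine (-1) 1 c b2 p.2).
  have NE : N q = p by rewrite /N /q /= !affineK // -surjective_pairing.
  by exists q; [apply/Npanel; rewrite NE|rewrite /= NE].
- move=> q cq; have [rB tB] := (Npanel q).2 cq.
  have [E _] := chart1_edges rB tB; apply: (iff_trans E).
  have [_ l1 l2] := affine_facts q.1 ab1 lt1.
  rewrite /N /= l1 l2; split=> [?|[//|/(no1 _ cq)//]].
  by left.
- move=> q cq; have [rB tB] := (Npanel q).2 cq.
  have [_ E] := chart1_edges rB tB; apply: (iff_trans E).
  have [_ l1 l2] := affine_facts q.2 cb lt2.
  by rewrite /N /= l1 l2 edge2.
Qed.

Lemma cts_hinge (T : topologicalType) (a w b : R) (f : T -> R) :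
  continuous f -> continuous (fun t => hinge a w b (f t)).
Proof.
move=> cf; apply: ctsD; apply: ctsM; try exact: ctsC.
  by apply: cts_min; [exact: cts_shift|exact: ctsC].
by apply: cts_max; [exact: cts_shift|exact: ctsC].
Qed.

Lemma level_genus2 : a1 < w1 < b1 -> a2 < w2 < b2 ->
  genus_surface R 2 (level_set V1 V2 w1 w2 e1 e2).
Proof.
move=> /andP[aw1 wb1] /andP[aw2 wb2].
have [Cin Cinj Csurj] := chart2_surface R.
pose h1 := hinge a1 w1 b1; pose h2 := hinge a2 w2 b2.
have m1 : {mono h1 : q q' / q <= q'} := hinge_mono aw1 wb1.
have m2 : {mono h2 : q q' / q <= q'} := hinge_mono aw2 wb2.
have [ha1 hw1 hb1] : [/\ h1 a1 = -1, h1 w1 = 0 & h1 b1 = 1] := hinge_values aw1 wb1.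
have [ha2 hw2 hb2] : [/\ h2 a2 = -1, h2 w2 = 0 & h2 b2 = 1] := hinge_values aw2 wb2.
have stairE q : config q <-> stair (h1 q.1) (h2 q.2).
  rewrite /config /stair.
  have := m1 a1 q.1; have := m1 q.1 b1; rewrite ha1 hb1 => -> ->.
  have := m2 a2 q.2; have := m2 q.2 b2; rewrite ha2 hb2 => -> ->.
  have := leW_mono m1 q.1 w1; have := leW_mono m2 q.2 w2.
  by rewrite hw1 hw2 => -> ->.
have lvl (k : R -> R) u v q : {mono k : q q' / q <= q'} -> k u = v -> k q = v <-> q = u.
  by move=> mk <-; split=> [/(inc_inj mk)|->].
pose N (q : R * R) := (stair_row (h1 q.1) (h2 q.2), stair_column (h1 q.1) (h2 q.2)).
have Npanel q : config q -> panel (N q).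
  move=> /stairE S; have [cB _ _ _] := stair_columnE S; split=> //=.
  by have [XB _] := stair_bound S; rewrite /stair_row; lra.
have cp := @position_continuous R V1 V2 w1 w2 e1 e2.
have ch1 : continuous (fun x : X => h1 (position x).1) by apply/cts_hinge/cts_fst.
have ch2 : continuous (fun x : X => h2 (position x).2) by apply/cts_hinge/cts_snd.
have ctread : continuous (fun x : X => tread (h1 (position x).1) (h2 (position x).2)).
  apply: cts_min; last exact: cts_max.
  by apply: ctsM; [apply: ctsD => //; exact: ctsC|exact: ctsC].
have crun : continuous (fun x : X => run (h1 (position x).1) (h2 (position x).2)).
  by apply: ctsB => //; apply: ctsD.
apply: (@level_genus _ _ _ _ _ _ _ _ _ _ _ W1 W2 2 (@chart2 R \o N)).
- apply: cts_chart; first exact: cts_sheet2.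
    by apply: cts_shift; apply: ctsM => //; exact: ctsC.
  apply: ctsM.
    by apply: ctsD => //; apply: cts_shift; apply: ctsM => //; exact: ctsC.
  apply: ctsV; last by apply: ctsB => //; exact: ctsC.
  move=> x; have /stairE S := position_config W1 W2 x.
  by have [XB _] := stair_bound S; rewrite gt_eqF //; lra.
- by move=> q /Npanel; exact: Cin.
- move=> q q' cq cq' /(Cinj _ _ (Npanel _ cq) (Npanel _ cq')) [r c].
  move/stairE in cq; move/stairE in cq'.
  have [x y] := stair_panel_inj cq cq' r c.
  by apply: injective_projections; [exact: (inc_inj m1)|exact: (inc_inj m2)].
- move=> s sS sy sz; have [[r t] [rB tB] pE] := Csurj s sS sy sz.
  have [x [y [S xr yt]]] := stair_panel_surj rB tB.
  have [q1 q1E] := hinge_surj x aw1 wb1.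
  have [q2 q2E] := hinge_surj y aw2 wb2.
  exists (q1, q2); first by apply/stairE; rewrite /= /h1 /h2 q1E q2E.
  by rewrite /= /N /= /h1 /h2 q1E q2E xr yt.
- move=> q cq; have [rB tB] := Npanel q cq.
  have [E _] := chart2_edges rB tB; apply: (iff_trans E).
  have [E' _] := stair_panel_edges ((stairE q).1 cq); apply: (iff_trans E').
  by rewrite (lvl _ _ _ _ m1 ha1) (lvl _ _ _ _ m1 hb1) (lvl _ _ _ _ m1 hw1) -{1}hw2 m2.
- move=> q cq; have [rB tB] := Npanel q cq.
  have [_ E] := chart2_edges rB tB; apply: (iff_trans E).
  have [_ E'] := stair_panel_edges ((stairE q).1 cq); apply: (iff_trans E').
  by rewrite (lvl _ _ _ _ m2 ha2) (lvl _ _ _ _ m2 hb2) (lvl _ _ _ _ m2 hw2) -{1}hw1 m1.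
Qed.
End Genus.

(** * Local cut points *)

(** x separates some neighbourhood of itself. *)
Definition local_cut_point (X : topologicalType) (x : X) : Prop :=
  exists A B : set X, [/\ open A /\ open B, A `&` B = set0,
    closure A x /\ closure B x, ~ A x /\ ~ B x & nbhs x (A `|` B `|` [set x])].

Lemma homeomorphic_local_cut_point (X Y : topologicalType) : homeomorphic X Y ->
  (exists x : X, local_cut_point x) -> exists y : Y, local_cut_point y.
Proof.
move=> [f [g [cf cg fK gK]]] [x [A [B [[oA oB] AB [clA clB] [nA nB] nx]]]].
have cl (C : set X) : closure C x -> closure (g @^-1` C) (f x).
  move=> clC U fU; have [z [Cz Uz]] := clC _ (cf _ _ fU).
  by exists (f z); split=> //=; rewrite fK.
exists (f x), (g @^-1` A), (g @^-1` B); split.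
- by move/continuousP: cg => cg; split; apply: cg.
- by rewrite -preimage_setI AB preimage_set0.
- by split; apply: cl.
- by rewrite /= fK.
- have : nbhs (f x) (g @^-1` (A `|` B `|` [set x])).
    by apply: cg; rewrite fK.
  apply: filterS => y /= [[?|?]|yx]; [by left; left|by left; right|].
  by right; rewrite -yx gK.
Qed.

Definition locally_connected_nonisolated (X : topologicalType) : Prop :=
  forall (x : X) (U : set X), nbhs x U ->
    exists V, [/\ nbhs x V, V `<=` U, connected V & exists2 y, V y & y <> x].

(** Take connected neighbourhoods I and J of the two coordinates.  In I * J
without the point (x, y), the columns u * J with u <> x and the rows I * v
with v <> y are connected and each column meets each row; together they cover
everything.  A connected set cannot be split between A and B. *)
Lemma prod_no_local_cut_point (X Y : topologicalType) :
  locally_connected_nonisolated X -> locally_connected_nonisolated Y -> forall p : X * Y, ~ local_cut_point p.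
Proof.
move=> nX nY [x y] [A [B [[oA oB] AB [clA clB] [nA nB]]]] [/= [U V] [/= Ux Vy] UV].
have [I [Ix IU cI [x1 Ix1 x1x]]] := nX _ _ Ux.
have [J [Jy JV cJ [y1 Jy1 y1y]]] := nY _ _ Vy.
have IJ u v : I u -> J v -> (u, v) <> (x, y) -> A (u, v) \/ B (u, v).
  move=> Iu Jv ne; have [[?|?]|//] := UV (u, v) (conj (IU _ Iu) (JV _ Jv)).
    by left.
  by right.
pose L (u : X) (v : Y) := (fun v' => (u, v')) @` J `|` (fun u' => (u', v)) @` I.
have cL u v : I u -> J v -> connected (L u v).
  move=> Iu Jv; apply: connectedU.
  - by exists (u, v); split; [exists v|exists u].
  - apply: connected_continuous_connected => //; apply: continuous_subspaceT => z.
    by apply: cvg_pair => //; exact: cvg_cst.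
  - apply: connected_continuous_connected => //; apply: continuous_subspaceT => z.
    by apply: cvg_pair => //; exact: cvg_cst.
pose W := \bigcup_(p in [set p : X * Y |
  [/\ I p.1, J p.2, p.1 <> x, p.2 <> y & p.1 = x1 \/ p.2 = y1]]) L p.1 p.2.
have cW : connected W.
  apply: bigcup_connected.
    exists (x1, y1) => -[u v] /= [Iu Jv _ _ [->|->]].
      by left; exists y1.
    by right; exists x1.
  by move=> [u v] [/= Iu Jv _ _ _]; exact: cL.
have WE u v : I u -> J v -> (u, v) <> (x, y) -> W (u, v).
  move=> Iu Jv ne; have [ux|ux] := pselect (u = x).
    have vy : v <> y by move=> vy; apply: ne; rewrite ux vy.
    exists (x1, v); first by split=> //; left.
    by right; exists u.
  exists (u, y1); first by split=> //; right.
  by left; exists v.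
have WAB : W `<=` A `|` B.
  move=> _ [[u v] [/= Iu Jv ux vy _] [[v' Jv' <-]|[u' Iu' <-]]]; apply: IJ => //; by case.
(* disjoint open sets are separated *)
have open_cl (C D : set (X * Y)%type) : open D -> C `&` D = set0 -> closure C `&` D = set0.
  move=> oD CD; rewrite -subset0 => z [clz Dz].
  have [w [Cw Dw]] := clz _ (open_nbhs_nbhs (conj oD Dz)).
  by have : (C `&` D) w by []; rewrite CD.
have sAB : separated A B.
  by split; [exact: open_cl|rewrite setIC; apply: open_cl; rewrite // setIC].
have nIJ : nbhs (x, y) (I `*` J) by exists (I, J).
have meet (C : set (X * Y)%type) : closure C (x, y) -> ~ C (x, y) ->
    exists2 z, C z & W z.
  move=> clC nC; have [[u v] [Cz [/= Iu Jv]]] := clC _ nIJ.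
  by exists (u, v) => //; apply: WE => // e; rewrite e in Cz.
have [zA Az Wz] := meet A clA nA; have [zB Bz Wz'] := meet B clB nB.
have [WA|WB] := connected_subset sAB WAB cW.
  suff: (A `&` B) zB by rewrite AB.
  by split=> //; exact: WA.
suff: (A `&` B) zA by rewrite AB.
by split=> //; exact: WB.
Qed.

(** * The torus has no local cut point *)

Section Torus.
Variable R : realType.

(** If g parametrizes C near u, with continuous inverse k on the open set O,
then the images of small intervals are connected neighbourhoods of u. *)
Lemma arc_neighborhood (T : topologicalType) (C : set T) (g : R -> C) (k : T -> R)
    (O : set T) (u : C) : continuous g -> continuous k -> open O -> O (set_val u) ->
  (forall v : C, O (set_val v) -> g (k (set_val v)) = v) ->
  (forall d, 0 < d -> exists2 t, `|k (set_val u) - t| < d & g t <> u) ->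
  forall U, nbhs u U ->
    exists V, [/\ nbhs u V, V `<=` U, connected V & exists2 y, V y & y <> u].
Proof.
move=> cg ck oO Ou gk other U nU; set t0 := k (set_val u).
have /nbhs_ballP [d /= d0 dU] : nbhs t0 (g @^-1` U) by apply: cg; rewrite /t0 gk.
exists (g @` ball t0 d); split.
- have cv := @set_val_continuous _ C.
  have nO : nbhs u (set_val @^-1` O) by apply: cv; exact: open_nbhs_nbhs.
  have nk : nbhs u ((k \o set_val) @^-1` ball t0 d).
    apply: (@continuous_comp _ _ _ set_val k); [exact: cv|exact: ck|exact: nbhsx_ballx].
  by apply: filterS (filterI nO nk) => v [Ov kv]; exists (k (set_val v)); rewrite ?gk.
- by move=> _ [t td <-]; exact: dU.
- apply: connected_continuous_connected; last exact: continuous_subspaceT.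
  by rewrite ball_itv; apply/connected_intervalP; exact: interval_is_interval.
- by have [t td gt] := other d d0; exists (g t) => //; exists t.
Qed.

(** A model circle for which everything is explicit: near its points off the
axis q = 0 it is a graph over p, and near those on this axis a graph over q.
Clamping the parameter keeps the graphs inside of the curve. *)
Definition round_curve : set (R * R) := [set u | energy (fun q => `|q|) u = 1/2].

Lemma clip_id (c x : R) : - c <= x <= c -> clip c x = x.
Proof. by move=> /andP[h1 h2]; rewrite /clip min_l // max_r. Qed.

Lemma clip_bound (c x : R) : 0 <= c -> - c <= clip c x <= c.
Proof. by move=> c0; case: (clipP x c0) => *; lra. Qed.

Lemma cts_clip_id (c : R) : continuous (clip c : R -> R).
Proof.
apply: cts_max; first exact: ctsC.
by apply: cts_min; [move=> ?; exact: cvg_id|exact: ctsC].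
Qed.

Lemma sign_of (x : R) : x != 0 -> exists2 s : R, s = 1 \/ s = -1 & 0 < s * x.
Proof.
by rewrite neq_lt => /orP[h|h]; [exists (-1); [right|]|exists 1; [left|]]; lra.
Qed.

Lemma sign_norm (s x : R) : s = 1 \/ s = -1 -> 0 <= s * x -> `|x| = s * x /\ x = s * `|x|.
Proof.
by case=> ->; rewrite ?mul1r ?mulN1r => h; [rewrite ger0_norm|rewrite ler0_norm ?opprK //]; lra.
Qed.

Lemma round_curve_locally_connected : locally_connected_nonisolated round_curve.
Proof.
move=> u; have h1 : 0 <= 1 :> R by lra.
have h2 : 0 <= 1/2 :> R by lra.
have k1 : continuous (fun v : R * R => v.1) by apply: cts_fst => ?; exact: cvg_id.
have k2 : continuous (fun v : R * R => v.2) by apply: cts_snd => ?; exact: cvg_id.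
have roundE (v : round_curve) : (set_val v).2 ^+ 2 / 2 + `|(set_val v).1| = 1/2.
  exact: (set_valP v).
have pB (v : round_curve) : -1 <= (set_val v).2 <= 1.
  by have := roundE v; have := normr_ge0 (set_val v).1; nra.
have [q0|q0] := eqVneq (set_val u).1 0; last first.
  have [s sE su] := sign_of q0.
  have gR t : (s * ((1 - clip 1 t ^+ 2) / 2), clip 1 t) \in round_curve.
    apply/mem_set; rewrite /round_curve /energy /= normrM.
    have -> : `|s| = 1 by case: sE => ->; rewrite ?normrN normr1.
    by have := clip_bound t h1 => ?; rewrite mul1r ger0_norm; [field|nra].
  pose g t : round_curve := exist (fun v => v \in round_curve) _ (gR t).
  have gE t : set_val (g t) = (s * ((1 - clip 1 t ^+ 2) / 2), clip 1 t) by [].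
  apply: (@arc_neighborhood _ round_curve g (fun v => v.2) [set v | 0 < s * v.1]) => //.
  - have cc := @cts_clip_id 1.
    apply: continuous_set_val; apply: cts_pair => //.
    apply: ctsM; first exact: ctsC.
    apply: ctsM; last exact: ctsC.
    by apply: ctsB; [exact: ctsC|apply: ctsM].
  - have /continuousP /(_ _ (@open_gt R 0)) // : continuous (fun v : R * R => s * v.1).
    by apply: ctsM => //; exact: ctsC.
  - move=> v /= vO; apply: set_val_inj; rewrite gE clip_id //.
    have [n1 n2] := sign_norm sE (ltW vO).
    rewrite [RHS]surjective_pairing; congr (_, _); rewrite [RHS]n2; congr (s * _).
    by have := roundE v; lra.
  - move=> d d0; set p := (set_val u).2.
    have [p1 p2] : -1 < p /\ p < 1.
      have [n1 _] := sign_norm sE (ltW su).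
      by have := roundE u; rewrite -/p; split; nra.
    pose m := Num.min (d / 2) (1/2).
    have [m0 md m1] : [/\ 0 < m, m < d & m <= 1/2].
      by rewrite /m; case: (leP (d / 2) (1/2)) => ?; split; lra.
    have [t [tp tB td]] : exists t, [/\ t != p, -1 <= t <= 1 & `|p - t| < d].
      have [s0|s0] := leP 0 p; [exists (p - m)|exists (p + m)]; split.
      + by rewrite lt_eqF //; lra.
      + by lra.
      + by rewrite opprB addrC subrK gtr0_norm.
      + by rewrite gt_eqF //; lra.
      + by lra.
      + by rewrite opprD addrA subrr add0r normrN gtr0_norm.
    exists t => // /(congr1 (fun v => (set_val v).2)).
    by rewrite gE /= clip_id // => /eqP; rewrite (negbTE tp).
have p1 : (set_val u).2 != 0.
  by apply/eqP => p0; have := roundE u; rewrite q0 p0 expr0n normr0 /=; lra.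
have [s sE su] := sign_of p1.
have gR t : (clip (1/2) t, s * Num.sqrt (1 - 2 * `|clip (1/2) t|)) \in round_curve.
  apply/mem_set; rewrite /round_curve /energy /= exprMn.
  have -> : s ^+ 2 = 1 by case: sE => ->; rewrite ?sqrrN expr1n.
  have := clip_bound t h2; rewrite -ler_norml => ?.
  by rewrite sqr_sqrtr; lra.
pose g t : round_curve := exist (fun v => v \in round_curve) _ (gR t).
have gE t : set_val (g t) = (clip (1/2) t, s * Num.sqrt (1 - 2 * `|clip (1/2) t|)) by [].
apply: (@arc_neighborhood _ round_curve g (fun v => v.1) [set v | 0 < s * v.2]) => //.
- have cc := @cts_clip_id (1/2).
  apply: continuous_set_val; apply: cts_pair => //.
  apply: ctsM; first exact: ctsC.
  move=> t; apply: continuous_comp; last exact: sqrt_continuous.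
  apply: ctsB; first exact: ctsC.
  by apply: ctsM; [exact: ctsC|exact: cts_norm].
- have /continuousP /(_ _ (@open_gt R 0)) // : continuous (fun v : R * R => s * v.2).
  by apply: ctsM => //; exact: ctsC.
- move=> v /= vO; have vE := roundE v.
  have qB : - (1/2) <= (set_val v).1 <= 1/2.
    by rewrite -ler_norml; have := sqr_ge0 (set_val v).2; lra.
  apply: set_val_inj; rewrite gE clip_id //.
  have [n1 n2] := sign_norm sE (ltW vO).
  rewrite [RHS]surjective_pairing; congr (_, _); rewrite [RHS]n2; congr (s * _).
  by rewrite -[RHS]sqrtr_sqr; congr Num.sqrt; lra.
- move=> d d0; pose m := Num.min (d / 2) (1/2).
  have [m0 md m1] : [/\ 0 < m, m < d & m <= 1/2].
    by rewrite /m; case: (leP (d / 2) (1/2)) => ?; split; lra.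
  exists m; first by rewrite q0 sub0r normrN gtr0_norm.
  move=> /(congr1 (fun v => (set_val v).1)); rewrite gE /= clip_id ?q0; last by lra.
  by move=> mE; rewrite mE ltxx in m0.
Qed.

Lemma round_curve_well : well (fun q : R => `|q|) (1/2) (- (1/2)) (1/2).
Proof.
split; first by move=> q; exact: norm_continuous.
- by lra.
- by move=> q; rewrite ler_norml.
- move=> q; split=> [|[->|->]]; last 2 first.
  + by rewrite normrN ger0_norm //; lra.
  + by rewrite ger0_norm //; lra.
  + by case: (ger0P q) => _ h; [right|left]; lra.
Qed.

(** With the potentials |q| and walls out of reach, nothing is identified and
the level set, which has genus one, is the product of two round curves. *)
Lemma torus_no_local_cut_point : forall s : standard_surface 1, ~ @local_cut_point (@standard_surface R 1) s.
Proof.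
suff H : exists Y : topologicalType,
    homeomorphic (@standard_surface R 1) Y /\ forall y : Y, ~ local_cut_point y.
  case: H => Y [h nY] s cs.
  by have [y cy] := homeomorphic_local_cut_point h (ex_intro _ s cs); exact: (nY y).
pose V (q : R) := `|q|.
have W := round_curve_well.
have g1 : genus_surface R 1 (level_set V V (-2) (-2) (1/2) (1/2)).
  apply: (@level_genus1 R V V _ _ _ _ _ _ _ _ W W (- (1/2))); first by lra.
  - move=> q; split=> [[? ? _] //|[h1 h2]]; split=> // -[? ?]; lra.
  - by move=> q [? ? _] [? _]; lra.
  - move=> q [? ? _]; split=> [[//|[? ?]]|]; [exfalso; lra|by left].
have trivial (x y : level_points V V (-2) (-2) (1/2) (1/2)) :
    impact (-2) (-2) (set_val x) (set_val y) -> False.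
  have [xB yB _] := position_config W W x.
  by case=> -[[? ?] _]; move: xB yB; rewrite /position /=; lra.
exists (round_curve * round_curve)%type; split; last exact: prod_no_local_cut_point round_curve_locally_connected round_curve_locally_connected.
apply: homeomorphic_trans (homeomorphic_sym g1) _.
have inround (x : level_points V V (-2) (-2) (1/2) (1/2)) : set_val x \in round_curve `*` round_curve.
  by apply/mem_set; have [_ ? ?] := levelP x.
pose f x : round_curve `*` round_curve := exist (fun v => v \in round_curve `*` round_curve) _ (inround x).
apply: (@homeomorphic_trans _ (round_curve `*` round_curve)); last first.
  exists (@setX_of_sigT _ _ round_curve round_curve), (@sigT_of_setX _ _ round_curve round_curve).
  split; [exact: setX_of_sigT_continuous|exact: sigT_of_setX_continuous
         |exact: setX_of_sigTK|exact: sigT_of_setXK].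
apply: (@compact_identification _ _ _ f).
- apply: compact_set_type; exact: (@level_points_compact R V V _ _ _ _ _ _ _ _ W W).
- exact/hausdorff_set_type/norm_hausdorff.
- by apply: continuous_set_val; exact: set_val_continuous.
- move=> x y; split=> [/(congr1 set_val) h|].
    by rewrite (@set_val_inj _ _ x y h); exact: rst_refl.
  by elim=> [{}x {}y /trivial//|//|{}x {}y _ ->//|{}x {}y z _ -> _ ->].
- move=> v; have vX : set_val v \in level_points V V (-2) (-2) (1/2) (1/2).
    apply/mem_set; have [v1 v2] := set_valP v; split=> // -[/= ? ?].
    have /= := energy_position W v1; lra.
  exists (exist (fun v => v \in level_points V V (-2) (-2) (1/2) (1/2)) _ vX).
  exact: set_val_inj.
Qed.
End Torus.

(** * Singular level sets *)

Section CutQuotient.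
Variables (X : topologicalType) (r : X -> X -> Prop).

Definition saturated (S : set X) : Prop := forall x y, r x y -> S x <-> S y.

Lemma saturated_glued S x y : saturated S -> clos_refl_sym_trans X r x y -> S x <-> S y.
Proof.
by move=> sS; elim=> [{}x {}y /sS//|{}x|{}x {}y _ h|{}x {}y z _ h _ h'];
  [|by rewrite h|by rewrite h].
Qed.

Lemma open_identify S : saturated S -> open S -> open (identify r @` S).
Proof.
move=> sS oS; apply: open_identification.
rewrite (_ : _ @^-1` _ = S) // eqEsubset; split=> [x [y Sy /identifyP xy]|x Sx]; last by exists x.
exact/(saturated_glued sS xy).
Qed.

(** In the quotient it is enough that the closures of A and B meet the class of
x0, possibly at different points. *)
Lemma identification_local_cut_point (A B N : set X) (x0 : X) :
  [/\ saturated A, saturated B & saturated N] -> [/\ open A, open B & open N] ->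
  A `&` B = set0 -> ~ A x0 -> ~ B x0 -> N x0 ->
  (forall y, N y -> [\/ A y, B y | clos_refl_sym_trans X r y x0]) ->
  (exists2 x, clos_refl_sym_trans X r x x0 & closure A x) ->
  (exists2 x, clos_refl_sym_trans X r x x0 & closure B x) ->
  local_cut_point (identify r x0).
Proof.
move=> [sA sB sN] [oA oB oN] AB nA nB Nx cover [xA gA clA] [xB gB clB].
have cl S x : clos_refl_sym_trans X r x x0 -> closure S x -> closure (identify r @` S) (identify r x0).
  move=> /identifyP <- clS U nU.
  have [y [Sy Uy]] := clS _ (@identify_continuous _ r _ _ nU).
  by exists (identify r y); split=> //; exists y.
have out S : saturated S -> ~ S x0 -> ~ (identify r @` S) (identify r x0).
  by move=> sS nS [y Sy /identifyP yx]; apply/nS/(saturated_glued sS yx).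
exists (identify r @` A), (identify r @` B); split.
- by split; exact: open_identify.
- rewrite -subset0 => _ [[x Ax <-] [y By /identifyP yx]].
  have : (A `&` B) x by split=> //; apply/(saturated_glued sB yx).
  by rewrite AB.
- by split; [exact: cl gA clA|exact: cl gB clB].
- by split; exact: out.
- apply: (@filterS _ _ _ (identify r @` N)); last first.
    by apply: open_nbhs_nbhs; split; [exact: open_identify|exists x0].
  move=> _ [y /cover [Ay|By|/identifyP yx] <-].
  + by left; left; exists y.
  + by left; right; exists y.
  + by right.
Qed.
End CutQuotient.

Lemma closure_curve (R : realType) (X : topologicalType) (g : R -> X) (A : set X) :
  continuous g -> (forall t, 0 < t < 1 -> A (g t)) -> closure A (g 0).
Proof.
move=> cg gA U nU; have /nbhs_ballP [d /= d0 dU] : nbhs (0 : R) (g @^-1` U) by apply: cg.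
exists (g (Num.min (d / 2) (1/2))).
by split; [apply: gA|apply: dU; rewrite /ball /= sub0r normrN gtr0_norm];
  case: (leP (d / 2) (1/2)) => ?; lra.
Qed.

Section SingularLeaf.
Variables (R : realType) (V1 V2 : R -> R) (w1 w2 e1 e2 a1 b1 a2 b2 : R).
Hypotheses (W1 : well V1 e1 a1 b1) (W2 : well V2 e2 a2 b2).
Hypothesis w2B : a2 < w2 < b2.
Local Notation X := (level_points V1 V2 w1 w2 e1 e2).
Local Notation r := (fun x y : X => impact w1 w2 (set_val x) (set_val y)).
Implicit Types x y : X.

Let cq1 : continuous (fun x => (position x).1).
Proof. by apply: cts_fst; exact: position_continuous. Qed.
Let cq2 : continuous (fun x => (position x).2).
Proof. by apply: cts_snd; exact: position_continuous. Qed.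

Lemma impact_cases x y : r x y ->
  ((position x).1 = w1 /\ y = reflect1 x) \/
  [/\ (position x).1 <= w1, (position x).2 = w2 & y = reflect2 x].
Proof.
move=> [[[h1 h2] E]|[[h1 h2] E]]; [left|right]; split=> //; exact: set_val_inj.
Qed.

Lemma impact_position x y : r x y -> position x = position y.
Proof. by move=> /impact_cases [[_ ->]|[_ _ ->]]. Qed.

Lemma position_saturated (P : R * R -> Prop) : saturated r [set x : X | P (position x)].
Proof. by move=> x y /impact_position /= ->. Qed.

Lemma reflect1_turn x : (set_val x).1.2 = 0 -> reflect1 x = x.
Proof.
move=> p0; apply: set_val_inj; apply: injective_projections => //.
by apply: injective_projections => //=; rewrite p0 oppr0.
Qed.

Lemma level_point u v : energy V1 u = e1 -> energy V2 v = e2 ->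
  ~ (u.1 < w1 /\ v.1 < w2) -> exists x, set_val x = (u, v).
Proof.
move=> E1 E2 nS; have xX : (u, v) \in X by apply/mem_set.
by exists (exist (fun z => z \in X) _ xX).
Qed.

Lemma level_curve (c1 c2 : R -> R * R) : continuous c1 -> continuous c2 ->
  (forall t, energy V1 (c1 t) = e1) -> (forall t, energy V2 (c2 t) = e2) ->
  (forall t, ~ ((c1 t).1 < w1 /\ (c2 t).1 < w2)) ->
  exists2 g : R -> X, continuous g & forall t, set_val (g t) = (c1 t, c2 t).
Proof.
move=> cc1 cc2 E1 E2 nS; have gX t : (c1 t, c2 t) \in X.
  by apply/mem_set; split; [exact: (nS t)|exact: E1|exact: E2].
exists (fun t => exist (fun z => z \in X) _ (gX t)) => //.
by apply: continuous_set_val; apply: cts_pair.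
Qed.

(** A path in the energy curve over the segment from q to q'. *)
Lemma energy_path (V : R -> R) e a b q q' : well V e a b -> a <= q <= b -> a <= q' <= b ->
  exists c : R -> R * R, [/\ continuous c, forall t, energy V (c t) = e,
    c 0 = lift_up V e q & forall t, 0 <= t <= 1 -> (c t).1 = q + t * (q' - q)].
Proof.
move=> W qB qB'; pose s (t : R) := q + ramp 1 t * (q' - q).
have cs : continuous s.
  apply: ctsD; first exact: ctsC.
  apply: ctsM; last exact: ctsC.
  by apply: cts_ramp; [exact: ctsC|move=> ?; exact: cvg_id].
have rB (t : R) : 0 <= ramp 1 t <= 1 by case: rampP; lra.
exists (fun t => lift_up V e (s t)); split.
- by move=> t; apply: continuous_comp; [exact: cs|exact: (lift_up_continuous W)].
- move=> t; apply: (lift_up_energy W); rewrite /s; have := rB t.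
  by case: (leP q q') => ? ?; nra.
- by rewrite /s (_ : ramp 1 0 = 0) ?mul0r ?addr0 //; case: rampP; lra.
- by move=> t tB; rewrite /= /s (_ : ramp 1 t = t) //; case: rampP; lra.
Qed.

(** The right turning point is on the wall.  Where q1 < b1 the step forces
q2 >= w2, and there the level set is a torus, whereas over q1 = b1 the
coordinate q2 can also go below w2: this gives a circle attached to the torus
at the corner (b1, w2), over which the points with opposite p2 are identified.
Removing this point separates the rest of the circle from the rest of the
torus. *)
Lemma local_cut_point_right : w1 = b1 ->
  exists z : level_set V1 V2 w1 w2 e1 e2, local_cut_point z.
Proof.
move=> w1E; have ab1 := well_lt W1.
have /andP[aw2 wb2] := w2B.
have bB : a1 <= b1 <= b1 by lra.
have w2B' : a2 <= w2 <= b2 by lra.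
have [x0 x0E] : exists x0, set_val x0 = (lift_up V1 e1 b1, lift_up V2 e2 w2).
  apply: level_point; [exact: (lift_up_energy W1)|exact: (lift_up_energy W2)|].
  by rewrite /= w1E; lra.
have turn x : (position x).1 = b1 -> (set_val x).1.2 = 0.
  by move=> q1; have [_ E _] := levelP x; apply/(energy_turn W1 E); right.
pose A := [set x : X | (position x).2 < w2].
pose B := [set x : X | (position x).1 < b1 \/ w2 < (position x).2].
suff C : local_cut_point (identify r x0) by exists (identify r x0).
apply: (@identification_local_cut_point X r A B setT x0).
- by split; [exact: (@position_saturated (fun q => q.2 < w2))|exact: (@position_saturated (fun q => q.1 < b1 \/ w2 < q.2))|].
- split; [|apply: openU|exact: openT].
  + by move/continuousP: cq2 => /(_ _ (@open_lt R w2)).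
  + by move/continuousP: cq1 => /(_ _ (@open_lt R b1)).
  + by move/continuousP: cq2 => /(_ _ (@open_gt R w2)).
- rewrite -subset0 => x [/= h1 [h2|h2]]; last by have := lt_trans h1 h2; rewrite ltxx.
  have [_ _] := position_config W1 W2 x; apply; split=> //.
  by apply: (lt_le_trans h2); rewrite w1E.
- by rewrite /A /position /= x0E /= ltxx.
- by rewrite /B /position /= x0E /= !ltxx => -[].
- by [].
- move=> y _; have [q1B q2B nS] := position_config W1 W2 y.
  have [h2|h2|h2] := ltgtP (position y).2 w2; [exact: Or31|by apply: Or32; right|].
  have [h1|h1] := ltP (position y).1 b1; first by apply: Or32; left.
  have {}h1 : (position y).1 = b1 by lra.
  apply: Or33; have [_ E E'] := levelP x0; have [_ F F'] := levelP y.
  rewrite x0E in E E'.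
  have e1E : (set_val y).1 = lift_up V1 e1 b1.
    apply: injective_projections => //; rewrite (turn _ h1).
    have : lift_up V1 e1 b1 = (set_val x0).1 by rewrite x0E.
    by move=> ->; rewrite turn // /position x0E.
  have [p|p] := energy_momentum F' E' h2.
    suff -> : y = x0 by exact: rst_refl.
    apply: set_val_inj; rewrite x0E; apply: injective_projections => //.
    exact: injective_projections.
  apply: rst_step; right; split; first by split; [have h1' : (set_val y).1.1 = b1 := h1; lra|].
  rewrite x0E; apply: injective_projections => //=.
  by apply: injective_projections => //=; rewrite p opprK.
- exists x0; first exact: rst_refl.
  have [|c2 [cc2 Ec2 c20 c2q]] := energy_path W2 w2B' (_ : a2 <= a2 <= b2); first by lra.
  have [|||||g cg gE] := @level_curve (fun=> lift_up V1 e1 b1) c2.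
  + by move=> ?; exact: cvg_cst.
  + exact: cc2.
  + by move=> t; exact: (lift_up_energy W1).
  + exact: Ec2.
  + by move=> t /=; rewrite w1E; lra.
  have <- : g 0 = x0 by apply: set_val_inj; rewrite gE c20 x0E.
  apply: closure_curve cg _ => t tB; rewrite /A /position /= gE /= c2q; last by lra.
  by nra.
- exists x0; first exact: rst_refl.
  have [|c2 [cc2 Ec2 c20 c2q]] := energy_path W2 w2B' (_ : a2 <= b2 <= b2); first by lra.
  have [|||||g cg gE] := @level_curve (fun=> lift_up V1 e1 b1) c2.
  + by move=> ?; exact: cvg_cst.
  + exact: cc2.
  + by move=> t; exact: (lift_up_energy W1).
  + exact: Ec2.
  + by move=> t /=; rewrite w1E; lra.
  have <- : g 0 = x0 by apply: set_val_inj; rewrite gE c20 x0E.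
  apply: closure_curve cg _ => t tB; rewrite /B /position /= gE /= c2q; last by lra.
  by right; nra.
Qed.

(** The left turning point is on the wall.  The level set is a torus before
identification, and the only effect of the impacts is to identify the two
points over the corner (a1, w2), which differ by the sign of p2; near the
resulting point the signs of p2 separate. *)
Lemma local_cut_point_left : w1 = a1 ->
  exists z : level_set V1 V2 w1 w2 e1 e2, local_cut_point z.
Proof.
move=> w1E; have ab1 := well_lt W1.
have /andP[aw2 wb2] := w2B.
have aB : a1 <= a1 <= b1 by lra.
have w2B' : a2 <= w2 <= b2 by lra.
have [x0 x0E] : exists x0, set_val x0 = (lift_up V1 e1 a1, lift_up V2 e2 w2).
  apply: level_point; [exact: (lift_up_energy W1)|exact: (lift_up_energy W2)|].
  by rewrite /= w1E; lra.
have pw0 : 0 < (lift_up V2 e2 w2).2.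
  by rewrite /= sqrtr_gt0; have := well_lt_energy W2 w2B; lra.
have turn x : (position x).1 = a1 -> (set_val x).1.2 = 0.
  by move=> q1; have [_ E _] := levelP x; apply/(energy_turn W1 E); left.
pose away (q : R * R) := [\/ a1 < q.1, q.2 < w2 | w2 < q.2].
pose A := [set x : X | 0 < (set_val x).2.2 /\ away (position x)].
pose B := [set x : X | (set_val x).2.2 < 0 /\ away (position x)].
pose N := [set x : X | (set_val x).2.2 != 0].
have [_ cp2] := @level_momenta_continuous R V1 V2 w1 w2 e1 e2.
have rcase x y : r x y -> x = y \/ (~ away (position x) /\ y = reflect2 x).
  move=> /impact_cases [[q1 ->]|[q1 q2 ->]]; [left|right].
    by rewrite reflect1_turn //; apply: turn; rewrite q1.
  by split=> // -[]; rewrite ?q2 ?ltxx // ltNge -w1E q1.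
have oaway : open [set x : X | away (position x)].
  have -> : [set x : X | away (position x)] = [set x : X | a1 < (position x).1] `|`
      ([set x : X | (position x).2 < w2] `|` [set x : X | w2 < (position x).2]).
    rewrite eqEsubset; split=> x /= => [[h|h|h]|[h|[h|h]]];
      [by left|by right; left|by right; right|exact: Or31|exact: Or32|exact: Or33].
  apply: openU; [|apply: openU].
  + by move/continuousP: cq1 => /(_ _ (@open_gt R a1)).
  + by move/continuousP: cq2 => /(_ _ (@open_lt R w2)).
  + by move/continuousP: cq2 => /(_ _ (@open_gt R w2)).
have x0_near : ~ away (position x0) by rewrite /away /position x0E /= !ltxx => -[].
have x0_glued : clos_refl_sym_trans X r (reflect2 x0) x0.
  apply: rst_sym; apply: rst_step; right; split=> //.
  by rewrite x0E; split=> /=; [rewrite w1E|].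
have path (v : R * R) (z : X) (S : set X) : energy V2 v = e2 -> v.1 = w2 ->
    set_val z = (lift_up V1 e1 a1, v) ->
    (forall x, (set_val x).2 = v -> away (position x) -> S x) -> closure S z.
  move=> Ev vq zE Sx.
  have [|c1 [cc1 Ec1 c10 c1q]] := energy_path W1 aB (_ : a1 <= b1 <= b1); first by lra.
  have [|||||g cg gE] := @level_curve c1 (fun=> v).
  + exact: cc1.
  + by move=> ?; exact: cvg_cst.
  + exact: Ec1.
  + by [].
  + by move=> t /= [h _]; have := energy_position W1 (Ec1 t); lra.
  have <- : g 0 = z by apply: set_val_inj; rewrite gE c10 zE.
  apply: closure_curve cg _ => t tB; apply: Sx; first by rewrite gE.
  by apply: Or31; rewrite /position gE /= c1q; [nra|lra].
suff C : local_cut_point (identify r x0) by exists (identify r x0).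
apply: (@identification_local_cut_point X r A B N x0).
- split=> x y /rcase [->//|[nw ->]].
  + by split=> -[_].
  + by split=> -[_].
  + by rewrite /N /= oppr_eq0.
- split.
  + by apply: openI oaway; move/continuousP: cp2 => /(_ _ (@open_gt R 0)).
  + by apply: openI oaway; move/continuousP: cp2 => /(_ _ (@open_lt R 0)).
  + by move/continuousP: cp2 => /(_ _ (@open_neq R 0)).
- by rewrite -subset0 => x [/= [h1 _] [h2 _]]; lra.
- by case.
- by case.
- by rewrite /N /= x0E gt_eqF.
- move=> y yN; have [aw|aw] := pselect (away (position y)).
    by move: yN; rewrite /N /= neq_lt => /orP[?|?]; [apply: Or32|apply: Or31].
  have [q1B q2B _] := position_config W1 W2 y.
  have h1 : (position y).1 = a1.
    by case: (ltP a1 (position y).1) => h; [case: aw; exact: Or31|lra].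
  have h2 : (position y).2 = w2.
    by case: (ltgtP (position y).2 w2) => h //; case: aw; [exact: Or32|exact: Or33].
  apply: Or33; have [_ E E'] := levelP x0; have [_ F F'] := levelP y.
  have e1E : (set_val y).1 = (set_val x0).1.
    apply: injective_projections; first by rewrite x0E.
    by rewrite !turn // /position x0E.
  have qE : (set_val y).2.1 = (set_val x0).2.1 by rewrite x0E; exact: h2.
  have [p|p] := energy_momentum F' E' qE.
    suff -> : y = x0 by exact: rst_refl.
    apply: set_val_inj; apply: injective_projections => //.
    exact: injective_projections.
  suff -> : y = reflect2 x0 by [].
  apply: set_val_inj; apply: injective_projections => //.
  exact: injective_projections.
- exists x0; first exact: rst_refl.
  apply: (path (lift_up V2 e2 w2)) => //; first exact: (lift_up_energy W2).
  by move=> x xv aw; split=> //; rewrite xv.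
- exists (reflect2 x0) => //.
  apply: (path (reflect_p (lift_up V2 e2 w2))) => //.
  + by rewrite energy_reflect; exact: (lift_up_energy W2).
  + by rewrite /= -[set_val (reflect2 x0)]/((set_val x0).1, reflect_p (set_val x0).2) x0E.
  + by move=> x xv aw; split=> //; rewrite xv /= oppr_lt0.
Qed.
End SingularLeaf.

(** * The foliation *)

Section Leaves.
Variable R : realType.
Implicit Types (V : R -> R) (w e h : R).

Lemma swap_continuous (S T : topologicalType) : continuous (fun x : S * T => (x.2, x.1)).
Proof. by apply: cts_pair; [apply: cts_snd|apply: cts_fst] => ?; exact: cvg_id. Qed.

Lemma level_set_swap V1 V2 w1 w2 e1 e2 :
  homeomorphic (level_set V1 V2 w1 w2 e1 e2) (level_set V2 V1 w2 w1 e2 e1).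
Proof.
have sw V V' w w' e e' (x : level_points V V' w w' e e') :
    ((set_val x).2, (set_val x).1) \in level_points V' V w' w e' e.
  by apply/mem_set; have [nS E E'] := levelP x; split=> // -[? ?]; exact: nS.
pose s V V' w w' e e' (x : level_points V V' w w' e e') : level_points V' V w' w e' e :=
  exist (fun z => z \in level_points V' V w' w e' e) _ (sw _ _ _ _ _ _ x).
have sE V V' w w' e e' x : set_val (@s V V' w w' e e' x) = ((set_val x).2, (set_val x).1) by [].
have cs V V' w w' e e' : continuous (@s V V' w w' e e').
  apply: continuous_set_val => x.
  apply: (@continuous_comp _ _ _ set_val (fun x => (x.2, x.1))); first exact: set_val_continuous.
  exact: swap_continuous.
have sK V V' w w' e e' : cancel (@s V V' w w' e e') (@s V' V w' w e' e).
  by move=> x; apply: set_val_inj; exact: injective_projections.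
have si V V' w w' e e' (x y : level_points V V' w w' e e') :
    impact w w' (set_val x) (set_val y) -> impact w' w (set_val (s _ _ _ _ _ _ x)) (set_val (s _ _ _ _ _ _ y)).
  by rewrite !sE => -[[[h1 h2] E]|[[h1 h2] E]]; [right|left]; split=> //; rewrite E.
apply: (@homeomorphic_identification _ _ _ _ (@s V1 V2 w1 w2 e1 e2) (@s V2 V1 w2 w1 e2 e1)).
- exact: cs.
- exact: cs.
- exact: sK.
- exact: sK.
- by move=> x y; exact: si.
- by move=> x y; exact: si.
Qed.

Lemma well_inside V w e a b : well V e a b -> V w < e -> a < w < b.
Proof.
move=> W Vw; have /(well_sub W) /andP[aw wb] : V w <= e by exact: ltW.
rewrite !lt_neqAle aw wb !andbT; apply/andP; split; apply/eqP => E; move: Vw.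
  by rewrite -E (well_turn W _).2 ?ltxx //; left.
by rewrite E (well_turn W _).2 ?ltxx //; right.
Qed.

Lemma well_outside V w e a b : well V e a b -> e < V w -> w < a \/ b < w.
Proof.
move=> W Vw; case: (ltP w a) => h; first by left.
case: (ltP b w) => h'; first by right.
have /(well_sub W) : a <= w <= b by rewrite h.
by rewrite leNgt Vw.
Qed.

Lemma genus1_below V1 V2 w1 w2 e1 e2 : confining_potential V1 -> confining_potential V2 ->
  0 < e1 < V1 w1 -> 0 < e2 -> V2 w2 < e2 ->
  genus_surface R 1 (level_set V1 V2 w1 w2 e1 e2).
Proof.
move=> hV1 hV2 /andP[e10 e1w] e20 e2w.
have [a1 [b1 [_ _ W1]]] := potential_well hV1 e10.
have [a2 [b2 [_ _ W2]]] := potential_well hV2 e20.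
have := well_inside W2 e2w => /andP[aw2 wb2].
have [wa|bw] := well_outside W1 e1w.
  apply: (@level_genus1 _ _ _ _ _ _ _ _ _ _ _ W1 W2 a2).
  - exact: (well_lt W2).
  - by move=> q; split=> [[]|[h1 h2]] //; split=> // -[? _]; lra.
  - by move=> q [? _ _] [? _]; lra.
  - by move=> q [? _ _]; split=> [[//|[? _]]|?]; [exfalso; lra|left].
apply: (@level_genus1 _ _ _ _ _ _ _ _ _ _ _ W1 W2 w2) => //.
- move=> q; split=> [[h1 h2 nS]|[h1 h2]].
    split=> //; apply/andP; split; last by lra.
    by rewrite leNgt; apply/negP => h; apply: nS; split=> //; lra.
  by split=> //; [lra|case; lra].
- by move=> q [? _ _] [? _]; lra.
- move=> q [h1 h2 nS]; split=> [[[h|h]|[_ h]]|[h|h]].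
  + by exfalso; apply: nS; split; lra.
  + by right.
  + by left.
  + by right; split=> //; lra.
  + by left; right.
Qed.

Lemma genus2_between V1 V2 w1 w2 e1 e2 : confining_potential V1 -> confining_potential V2 ->
  0 < e1 -> V1 w1 < e1 -> 0 < e2 -> V2 w2 < e2 ->
  genus_surface R 2 (level_set V1 V2 w1 w2 e1 e2).
Proof.
move=> hV1 hV2 e10 e1w e20 e2w.
have [a1 [b1 [_ _ W1]]] := potential_well hV1 e10.
have [a2 [b2 [_ _ W2]]] := potential_well hV2 e20.
exact: (level_genus2 W1 W2 (well_inside W1 e1w) (well_inside W2 e2w)).
Qed.

Lemma singular_not_torus V1 V2 w1 w2 e1 e2 : confining_potential V1 -> confining_potential V2 ->
  0 < e1 -> V1 w1 = e1 -> 0 < e2 -> V2 w2 < e2 ->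
  ~ genus_surface R 1 (level_set V1 V2 w1 w2 e1 e2).
Proof.
move=> hV1 hV2 e10 e1w e20 e2w g1.
have [a1 [b1 [_ _ W1]]] := potential_well hV1 e10.
have [a2 [b2 [_ _ W2]]] := potential_well hV2 e20.
have w2B := well_inside W2 e2w.
have [s cs] : exists s : @standard_surface R 1, local_cut_point s.
  apply: (homeomorphic_local_cut_point g1).
  by have [E|E] := (well_turn W1 w1).1 e1w; [exact: (local_cut_point_left W1 W2)|exact: (local_cut_point_right W1 W2)].
exact: (@torus_no_local_cut_point R s cs).
Qed.

Lemma genus_unchanged (F : R -> topologicalType) g (l u e : R) : l < e < u ->
  (forall e', l < e' < u -> genus_surface R g (F e')) -> ~ topology_changes_at F e.
Proof.
move=> /andP[le eu] G; apply; have ge := G e; rewrite le eu in ge.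
have nl : \forall e' \near e, l < e' by exact: lt_nbhsr.
have nu : \forall e' \near e, e' < u by exact: lt_nbhsl.
near=> e'; apply: homeomorphic_trans (homeomorphic_sym (ge isT)); apply: G.
by apply/andP; split; near: e'.
Unshelve. all: by end_near. Qed.

End Leaves.

Unset Implicit Arguments.

Theorem corollary2p3 (R : realType) (V1 V2 : R -> R) (q1wall q2wall : R)
    (hV1 : confining_potential V1) (hV2 : confining_potential V2)
    (hwall : q1wall * q2wall != 0)
    (h : R) (hh : V1 q1wall + V2 q2wall < h) :
  let h1step := V1 q1wall in
  let h2step := V2 q2wall in
  let L := leaf V1 V2 q1wall q2wall h in
  [/\ h1step < h - h2step,
      [set e1 : R | 0 < e1 < h /\ topology_changes_at L e1] =
        [set h1step; h - h2step],
      forall e1 : R, 0 < e1 < h1step -> genus_surface R 1 (L e1),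
      forall e1 : R, h1step < e1 < h - h2step -> genus_surface R 2 (L e1) &
      forall e1 : R, h - h2step < e1 < h -> genus_surface R 1 (L e1)].
Proof.
move=> h1step h2step L.
have [w10 w20] : q1wall != 0 /\ q2wall != 0 by move: hwall; rewrite mulf_eq0 negb_or => /andP.
have h1 : 0 < h1step by exact: potential_pos.
have h2 : 0 < h2step by exact: potential_pos.
have h12 : h1step < h - h2step by rewrite ltrBrDr.
have low e1 : 0 < e1 < h1step -> genus_surface R 1 (L e1).
  by move=> eB; apply: genus1_below => //; rewrite -/h2step; lra.
have mid e1 : h1step < e1 < h - h2step -> genus_surface R 2 (L e1).
  by move=> eB; apply: genus2_between => //; rewrite -/h1step -/h2step; lra.
have high e1 : h - h2step < e1 < h -> genus_surface R 1 (L e1).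
  move=> eB; apply: homeomorphic_trans (level_set_swap _ _ _ _ _ _) _.
  by apply: genus1_below => //; rewrite -/h1step -/h2step; lra.
split=> //.
rewrite eqEsubset; split=> [e1 [/andP[e0 eh] ch]|e1 /= [->|->]].
- apply: contrapT => /not_orP [/eqP n1 /eqP n2].
  case: (ltgtP e1 h1step) n1 => // e1h _.
    by apply: (genus_unchanged (l := 0) (u := h1step) _ low ch); lra.
  case: (ltgtP e1 (h - h2step)) n2 => // e1h' _.
    by apply: (genus_unchanged (l := h1step) (u := h - h2step) _ mid ch); lra.
  by apply: (genus_unchanged (l := h - h2step) (u := h) _ high ch); lra.
- split; first by lra.
  move=> /nbhs_ballP [d /= d0 near].
  pose m := Num.min (d / 2) (h1step / 2).
  have [m0 md mh] : [/\ 0 < m, m < d & m < h1step].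
    by rewrite /m; case: (leP (d / 2) (h1step / 2)) => ?; split; lra.
  have /near hom : ball h1step d (h1step - m).
    by rewrite /ball /= opprB addrC subrK gtr0_norm.
  have /singular_not_torus : genus_surface R 1 (L h1step).
    by apply: homeomorphic_trans (homeomorphic_sym hom) (low _ _); lra.
  by apply=> //; rewrite -/h2step; lra.
- split; first by lra.
  move=> /nbhs_ballP [d /= d0 near].
  pose m := Num.min (d / 2) (h2step / 2).
  have [m0 md mh] : [/\ 0 < m, m < d & m < h2step].
    by rewrite /m; case: (leP (d / 2) (h2step / 2)) => ?; split; lra.
  have /near hom : ball (h - h2step) d (h - h2step + m).
    by rewrite /ball /= opprD addrA subrr add0r normrN gtr0_norm.
  have : genus_surface R 1 (level_set V2 V1 q2wall q1wall (h - (h - h2step)) (h - h2step)).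
    apply: homeomorphic_trans (level_set_swap _ _ _ _ _ _) _.
    by apply: homeomorphic_trans (homeomorphic_sym hom) (high _ _); lra.
  by apply/singular_not_torus => //; rewrite -/h1step -/h2step; lra.
Qed.
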